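(* The free $C^\infty$-ring monad $\mathsf{S}^\infty$ on $\mathbb{R}\text{-}\mathrm{Vec}$, with its deriving transformation $\mathsf{d}$, has the structure of a codifferential category with antiderivatives (that is, the natural transformation $\mathsf{K}:S^\infty\Rightarrow S^\infty$ is an isomorphism), and therefore also the structure of a co-calculus category, with integral transformation $\mathsf{s}=\mathsf{d}^\circ\mathsf{K}^{-1}$.
   Context: Conventions: composition in diagrammatic order ($fg$ means first $f$, then $g$); associators and unitors suppressed; $\sigma$ denotes the symmetry. $\mathbb{R}\text{-}\mathrm{Vec}$ is the category of real vector spaces with its usual tensor product (unit $k=\mathbb{R}$) and addition of linear maps. Algebra modality on a symmetric monoidal category: a monad $(S,\mu,\eta)$ with natural transformations $\mathsf{m}_C:SC\otimes SC\to SC$, $\mathsf{u}_C:k\to SC$ making each $SC$ a commutative monoid and each $\mu_C$ a monoid morphism. Deriving transformation (giving a codifferential category): natural $\mathsf{d}_C:SC\to SC\otimes C$ with [d.1] $\mathsf{u}\mathsf{d}=0$; [d.2] $\mathsf{m}\mathsf{d}=(1\otimes\mathsf{d})(\mathsf{m}\otimes1)+(\mathsf{d}\otimes1)(1\otimes\sigma)(\mathsf{m}\otimes1)$; [d.3] $\eta\mathsf{d}=\mathsf{u}\otimes1$; [d.4] $\mu\mathsf{d}=\mathsf{d}(\mu\otimes\mathsf{d})(\mathsf{m}\otimes1)$; [d.5] $\mathsf{d}(\mathsf{d}\otimes1)=\mathsf{d}(\mathsf{d}\otimes1)(1\otimes\sigma)$. Integral transformation (giving a co-integral category): natural $\mathsf{s}_C:SC\otimes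 C\to SC$ with [s.1] $(\mathsf{u}\otimes1)\mathsf{s}=\eta$; [s.2] $(\mathsf{s}\otimes\mathsf{s})\mathsf{m}=(\mathsf{s}\otimes1\otimes1)(\mathsf{m}\otimes1)\mathsf{s}+(1\otimes1\otimes\mathsf{s})(1\otimes\sigma)(\mathsf{m}\otimes1)\mathsf{s}$; [s.3] $(\mathsf{s}\otimes1)\mathsf{s}=(1\otimes\sigma)(\mathsf{s}\otimes1)\mathsf{s}$. Co-calculus category: a codifferential category and a co-integral category on the same algebra modality such that [c.1] $\mathsf{d}\mathsf{s}+S(0)=1$; [c.2] if $f:B\to SC\otimes C$ satisfies $f(\mathsf{d}\otimes1)(1\otimes\sigma)=f(\mathsf{d}\otimes1)$ then $f\mathsf{s}\mathsf{d}=f$. In a codifferential category, define $\mathsf{d}^\circ_C=(1\otimes\eta_C)\mathsf{m}_C:SC\otimes C\to SC$ (coderiving transformation), $\mathsf{L}=\mathsf{d}\mathsf{d}^\circ$ and $\mathsf{K}=\mathsf{L}+S(0)$, both natural transformations $S\Rightarrow S$, where $S(0)$ has components $S(0:C\to C)$. The codifferential category has antiderivatives if $\mathsf{K}$ is a natural isomorphism. $C^\infty$-rings: a $C^\infty$-ring $(X,\Phi)$ is a set $X$ with an operation $\Phi_f:X^m\to X$ for each smooth $f:\mathbb{R}^m\to\mathbb{R}$, $m\in\mathbb{N}$, such that $\Phi_{\pi_i}$ is the $i$-th projection and $\Phi_{g\circ\langle f_1,\dots,f_m\rangle}=\Phi_g\circ\langle\Phi_{f_1},\dots,\Phi_{f_m}\rangle$;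 morphisms preserve all operations. Each has an underlying commutative $\mathbb{R}$-algebra (from the polynomial operations). The forgetful functor from $C^\infty$-rings to $\mathbb{R}\text{-}\mathrm{Vec}$ has a left adjoint; $\mathsf{S}^\infty=(S^\infty,\mu,\eta)$ is the induced (finitary) monad, and $\mathsf{m}_V,\mathsf{u}_V$ are the multiplication and unit of the $\mathbb{R}$-algebra underlying the free $C^\infty$-ring $S^\infty(V)$. One has $S^\infty(\mathbb{R}^n)=C^\infty(\mathbb{R}^n)$ with operations $\Phi_g(f_1,\dots,f_m)=g\circ\langle f_1,\dots,f_m\rangle$, $\eta_{\mathbb{R}^n}(e_i)=\pi_i$, and $S^\infty(h)(g)=g\circ h^*$ for linear $h$ with transpose $h^*$. The transformation $\mathsf{d}:S^\infty(-)\Rightarrow S^\infty(-)\otimes(-)$ is the unique natural transformation with $\mathsf{d}_{\mathbb{R}^n}(f)=\sum_{i=1}^n\frac{\partial f}{\partial x_i}\otimes e_i$ for all $n$ and $f\in C^\infty(\mathbb{R}^n)$ (natural transformations between finitary endofunctors of $\mathbb{R}\text{-}\mathrm{Vec}$ are determined by, and extend uniquely from, their restrictions to the full subcategory on the spaces $\mathbb{R}^n$). *)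

(* Defs.v *)
From HB Require Import structures.
From mathcomp Require Import all_boot all_order all_algebra.
From mathcomp Require Import all_classical all_reals all_analysis.
Set Implicit Arguments.
Unset Strict Implicit.
Unset Printing Implicit Defensive.
Import Order.TTheory GRing.Theory Num.Theory numFieldNormedType.Exports.
Local Open Scope classical_set_scope.
Local Open Scope quotient_scope.
Local Open Scope ring_scope.

Section smooth_functions.
Context {R : realType}.

Definition partial m (i : 'I_m) (f : 'rV[R]_m -> R) : 'rV[R]_m -> R :=
  fun x => 'D_'e_i f x.

(* C^k: continuous if k = 0; differentiable with partial derivatives of class
   C^(k-1) otherwise.  The dimension m may be 0. *)
Fixpoint Ck (k : nat) m (f : 'rV[R]_m -> R) : Prop :=
  if k is k'.+1 then
    (forall x, differentiable f x) /\ (forall i, Ck k' (partial i f))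
  else continuous f.

Definition smooth m (f : 'rV[R]_m -> R) : Prop := forall k, Ck k f.

Lemma CkS_diff k m (f : 'rV[R]_m -> R) x : Ck k.+1 f -> differentiable f x.
Proof. by case=> + _; apply. Qed.

Lemma CkS_partial k m (f : 'rV[R]_m -> R) i : Ck k.+1 f -> Ck k (partial i f).
Proof. by case=> _; apply. Qed.

Lemma CkW k m (f : 'rV[R]_m -> R) : Ck k.+1 f -> Ck k f.
Proof.
elim: k f => [|k IHk] f cf.
  by move=> x; apply: differentiable_continuous; exact: CkS_diff cf.
split=> [x|i]; first exact: CkS_diff cf.
by apply: IHk; exact: CkS_partial.
Qed.

Lemma CkD k m (f g : 'rV[R]_m -> R) : Ck k f -> Ck k g -> Ck k (f \+ g).
Proof.
elim: k f g => [|k IHk] f g cf cg.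
  by move=> x; exact: (continuousD (cf x) (cg x)).
have df x : differentiable f x by exact: CkS_diff cf.
have dg x : differentiable g x by exact: CkS_diff cg.
split=> [x|i]; first exact: differentiableD.
rewrite (_ : partial i _ = partial i f \+ partial i g).
  by apply: IHk; exact: CkS_partial.
by apply/funext => x; rewrite /partial deriveD//; exact: diff_derivable.
Qed.

Lemma CkM k m (f g : 'rV[R]_m -> R) : Ck k f -> Ck k g -> Ck k (f \* g).
Proof.
elim: k f g => [|k IHk] f g cf cg.
  by move=> x; exact: (continuousM (cf x) (cg x)).
have df x : differentiable f x by exact: CkS_diff cf.
have dg x : differentiable g x by exact: CkS_diff cg.
split=> [x|i]; first exact: differentiableM.
rewrite (_ : partial i _ = (f \* partial i g) \+ (g \* partial i f)).
  by apply: CkD; apply: IHk; by [exact: CkW|exact: CkS_partial].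
by apply/funext => x; rewrite /partial deriveM//; exact: diff_derivable.
Qed.

Lemma Ck_cst k m (c : R) : Ck k (cst c : 'rV[R]_m -> R).
Proof.
elim: k c => [|k IHk] c; first exact: cst_continuous.
split=> [x|i]; first exact: differentiable_cst.
rewrite (_ : partial i _ = cst 0); first exact: IHk.
by apply/funext => x; exact: derive_cst.
Qed.

Lemma partial_coord m (i j : 'I_m) :
  partial i (fun x : 'rV[R]_m => x 0 j) = cst ((j == i)%:R).
Proof.
apply/funext => x; rewrite /partial.
have /derive_mx/matrixP/(_ 0 j) : derivable (id : 'rV[R]_m -> 'rV[R]_m) x 'e_i.
  exact: derivable_id.
by rewrite derive_id !mxE => <-.
Qed.

Lemma Ck_coord k m (j : 'I_m) : Ck k (fun x : 'rV[R]_m => x 0 j).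
Proof.
case: k => [|k].
  by move=> x; exact/differentiable_continuous/differentiable_coord.
split=> [x|i]; first exact: differentiable_coord.
by rewrite partial_coord; exact: Ck_cst.
Qed.

Lemma Ck_sum k m n (f : 'I_n -> 'rV[R]_m -> R) :
  (forall i, Ck k (f i)) -> Ck k (fun x => \sum_(i < n) f i x).
Proof.
elim: n f => [|n IHn] f cf.
  rewrite (_ : (fun _ => _) = cst 0); first exact: Ck_cst.
  by apply/funext => x; rewrite big_ord0.
rewrite (_ : (fun _ => _) = (fun x => f ord0 x) \+ (fun x => \sum_(i < n) f (lift ord0 i) x)).
  by apply: CkD; [exact: cf|apply: IHn => i; exact: cf].
by apply/funext => x; rewrite big_ord_recl.
Qed.

Lemma differentiable_row m n (f : 'I_n -> 'rV[R]_m -> R) x :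
  (forall j, differentiable (f j) x) -> differentiable (fun y => \row_j f j y) x.
Proof.
move=> df.
rewrite (_ : (fun y => _) = \sum_(j < n) (fun y => f j y *: delta_mx 0 j)).
  by apply: differentiable_sum => j; exact: differentiableZl.
by apply/funext => y; rewrite fct_sumE [LHS]row_sum_delta; under eq_bigr do rewrite mxE.
Qed.

Lemma partial_comp m n (g : 'rV[R]_n -> R) (f : 'I_n -> 'rV[R]_m -> R) i :
  (forall y, differentiable g y) -> (forall j x, differentiable (f j) x) ->
  partial i (fun x => g (\row_j f j x)) =
  (fun x => \sum_(j < n) partial j g (\row_j f j x) * partial i (f j) x).
Proof.
move=> dg df; apply/funext => x; rewrite /partial.
have drow : differentiable (fun y => \row_j f j y) x by exact: differentiable_row.
rewrite deriveE; last exact: differentiable_comp.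
rewrite diff_comp//= -(deriveE _ drow).
rewrite derive_mx; last exact: diff_derivable.
rewrite [X in 'd g _ X]row_sum_delta linear_sum; apply: eq_bigr => j _.
rewrite linearZ/= -deriveE// !mxE (_ : (fun _ => _) = f j); first exact: mulrC.
by apply/funext => y; rewrite mxE.
Qed.

Lemma Ck_comp k m n (g : 'rV[R]_n -> R) (f : 'I_n -> 'rV[R]_m -> R) :
  Ck k.+1 g -> (forall j, Ck k.+1 (f j)) -> Ck k (fun x => g (\row_j f j x)).
Proof.
elim: k g f => [|k IHk] g f cg cf.
  move=> x; apply: differentiable_continuous; apply: differentiable_comp.
    by apply: differentiable_row => j; exact: CkS_diff (cf j).
  exact: CkS_diff cg.
have dg y : differentiable g y by exact: CkS_diff cg.
split=> [x|i].
  by apply: differentiable_comp => //; apply: differentiable_row => j; exact: CkS_diff (cf j).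
rewrite partial_comp//; last by move=> j x; exact: CkS_diff (cf j).
apply: Ck_sum => j; apply: CkM; last by apply/CkW/CkS_partial.
apply: IHk => [|l]; [exact: CkS_partial|exact: CkW].
Qed.

End smooth_functions.

Record smooth_fun (R : realType) (m : nat) := SmoothFun {
  sfun :> 'rV[R]_m -> R;
  sfun_smooth : smooth sfun }.

Section smooth_fun_operations.
Context {R : realType}.

Lemma sfun_ext m (f g : smooth_fun R m) : (forall x, f x = g x) -> f = g.
Proof.
case: f g => [f sf] [g sg] /= /funext fg; rewrite fg in sf *.
by rewrite (Prop_irrelevance sf sg).
Qed.

Definition sf_proj m (i : 'I_m) : smooth_fun R m :=
  SmoothFun (fun k => Ck_coord k i).

Definition sf_comp m n (g : smooth_fun R n) (f : 'I_n -> smooth_fun R m) :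
    smooth_fun R m :=
  SmoothFun (fun k =>
    Ck_comp (sfun_smooth g k.+1) (fun j => sfun_smooth (f j) k.+1)).

Definition sf_partial m (i : 'I_m) (f : smooth_fun R m) : smooth_fun R m :=
  SmoothFun (fun k => CkS_partial i (sfun_smooth f k.+1)).

Definition sf_cst m (c : R) : smooth_fun R m := SmoothFun (fun k => Ck_cst k m c).

Definition sf_add m (f g : smooth_fun R m) : smooth_fun R m :=
  SmoothFun (fun k => CkD (sfun_smooth f k) (sfun_smooth g k)).

Definition sf_mul m (f g : smooth_fun R m) : smooth_fun R m :=
  SmoothFun (fun k => CkM (sfun_smooth f k) (sfun_smooth g k)).

End smooth_fun_operations.

(* A set with an operation for each smooth function R^m -> R, preserving the
   coordinate projections and composition. *)
Record CinfRing (R : realType) := MkCinfRing {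
  csort :> Type;
  cop : forall m, smooth_fun R m -> ('I_m -> csort) -> csort;
  cop_proj : forall m (i : 'I_m) (x : 'I_m -> csort), cop (sf_proj i) x = x i;
  cop_comp : forall m n (g : smooth_fun R n) (f : 'I_n -> smooth_fun R m)
      (x : 'I_m -> csort),
    cop (sf_comp g f) x = cop g (fun j => cop (f j) x) }.

Arguments csort {R} _ : simpl never.
Arguments cop {R c m} f x : simpl never.

Definition cinf_morphism (R : realType) (A B : CinfRing R) (phi : A -> B) :=
  forall m (f : smooth_fun R m) (x : 'I_m -> A),
    phi (cop f x) = cop f (phi \o x).

(* The commutative R-algebra underlying a C^oo-ring: its operations are those
   attached to polynomials.  The zero ring is a C^oo-ring, so that csort A is only
   a comPzRingType and an lmodType (the library's algebras are nonzero);
   compatibility of scaling and product is cinf_scalerAl. *)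
Section underlying_algebra.
Context {R : realType} (A : CinfRing R).
Implicit Types (x y z : A) (c : R).

Let no_arg (i : 'I_0) : A := False_rect A (notF (ltn_ord i)).
Let args2 x y (i : 'I_2) : A := tnth [tuple x; y] i.
Let args3 x y z (i : 'I_3) : A := tnth [tuple x; y; z] i.

Definition ccst c : A := cop (sf_cst 0 c) no_arg.
Definition cadd x y : A := cop (sf_add (sf_proj 0) (sf_proj 1)) (args2 x y).
Definition cmul x y : A := cop (sf_mul (sf_proj 0) (sf_proj 1)) (args2 x y).
Definition copp x : A := cmul (ccst (-1)) x.
Definition cscale c x : A := cmul (ccst c) x.

Lemma cop_cst m c (a : 'I_m -> A) : cop (sf_cst m c) a = ccst c.
Proof.
rewrite (_ : sf_cst m c = sf_comp (sf_cst 0 c) (fun i => sf_cst m 0)); last first.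
  exact: sfun_ext.
by rewrite cop_comp; congr cop; apply/funext => -[].
Qed.

Lemma cop_add m (f g : smooth_fun R m) (a : 'I_m -> A) :
  cop (sf_add f g) a = cadd (cop f a) (cop g a).
Proof.
rewrite (_ : sf_add f g = sf_comp (sf_add (sf_proj 0) (sf_proj 1))
  (tnth [tuple f; g])); last by apply: sfun_ext => y /=; rewrite !mxE.
by rewrite cop_comp; congr cop; apply/funext => -[[|[|//]] ?].
Qed.

Lemma cop_mul m (f g : smooth_fun R m) (a : 'I_m -> A) :
  cop (sf_mul f g) a = cmul (cop f a) (cop g a).
Proof.
rewrite (_ : sf_mul f g = sf_comp (sf_mul (sf_proj 0) (sf_proj 1))
  (tnth [tuple f; g])); last by apply: sfun_ext => y /=; rewrite !mxE.
by rewrite cop_comp; congr cop; apply/funext => -[[|[|//]] ?].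
Qed.

Let to_ops m (a : 'I_m -> A) i : a i = cop (sf_proj i) a.
Proof. by rewrite cop_proj. Qed.

Lemma caddA : associative cadd.
Proof.
move=> x y z; suff H (a : 'I_3 -> A) :
    cadd (a 0) (cadd (a 1) (a 2)) = cadd (cadd (a 0) (a 1)) (a 2).
  exact: (H (args3 x y z)).
rewrite !(to_ops a) -!cop_add; congr cop.
by apply: sfun_ext => v /=; rewrite addrA.
Qed.

Lemma caddC : commutative cadd.
Proof.
move=> x y; suff H (a : 'I_2 -> A) : cadd (a 0) (a 1) = cadd (a 1) (a 0).
  exact: (H (args2 x y)).
rewrite !(to_ops a) -!cop_add; congr cop.
by apply: sfun_ext => v /=; rewrite addrC.
Qed.

Lemma cadd0 : left_id (ccst 0) cadd.
Proof.
move=> x; suff H (a : 'I_1 -> A) : cadd (ccst 0) (a 0) = a 0.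
  exact: (H (fun=> x)).
rewrite !(to_ops a) -(cop_cst 0 a) -!cop_add; congr cop.
by apply: sfun_ext => v /=; rewrite add0r.
Qed.

Lemma caddN : left_inverse (ccst 0) copp cadd.
Proof.
move=> x; suff H (a : 'I_1 -> A) : cadd (copp (a 0)) (a 0) = ccst 0.
  exact: (H (fun=> x)).
rewrite /copp !(to_ops a) -(cop_cst _ a) -(cop_cst 0 a) -!(cop_add, cop_mul).
by congr cop; apply: sfun_ext => v /=; rewrite mulN1r addNr.
Qed.

Lemma cmulA : associative cmul.
Proof.
move=> x y z; suff H (a : 'I_3 -> A) :
    cmul (a 0) (cmul (a 1) (a 2)) = cmul (cmul (a 0) (a 1)) (a 2).
  exact: (H (args3 x y z)).
rewrite !(to_ops a) -!cop_mul; congr cop.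
by apply: sfun_ext => v /=; rewrite mulrA.
Qed.

Lemma cmulC : commutative cmul.
Proof.
move=> x y; suff H (a : 'I_2 -> A) : cmul (a 0) (a 1) = cmul (a 1) (a 0).
  exact: (H (args2 x y)).
rewrite !(to_ops a) -!cop_mul; congr cop.
by apply: sfun_ext => v /=; rewrite mulrC.
Qed.

Lemma cmul1 : left_id (ccst 1) cmul.
Proof.
move=> x; suff H (a : 'I_1 -> A) : cmul (ccst 1) (a 0) = a 0.
  exact: (H (fun=> x)).
rewrite !(to_ops a) -(cop_cst 1 a) -!cop_mul; congr cop.
by apply: sfun_ext => v /=; rewrite mul1r.
Qed.

Lemma cmulDl : left_distributive cmul cadd.
Proof.
move=> x y z; suff H (a : 'I_3 -> A) :
    cmul (cadd (a 0) (a 1)) (a 2) = cadd (cmul (a 0) (a 2)) (cmul (a 1) (a 2)).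
  exact: (H (args3 x y z)).
rewrite !(to_ops a) -!(cop_add, cop_mul); congr cop.
by apply: sfun_ext => v /=; rewrite mulrDl.
Qed.

Lemma ccstD c1 c2 : ccst (c1 + c2) = cadd (ccst c1) (ccst c2).
Proof. by rewrite -cop_add; congr cop; exact: sfun_ext. Qed.

Lemma ccstM c1 c2 : ccst (c1 * c2) = cmul (ccst c1) (ccst c2).
Proof. by rewrite -cop_mul; congr cop; exact: sfun_ext. Qed.

HB.instance Definition _ := gen_eqMixin (csort A).
HB.instance Definition _ := gen_choiceMixin (csort A).
HB.instance Definition _ :=
  GRing.isZmodule.Build (csort A) caddA caddC cadd0 caddN.
HB.instance Definition _ :=
  GRing.Zmodule_isComPzRing.Build (csort A) cmulA cmulC cmul1 cmulDl.

Lemma cscaleA c1 c2 x : cscale c1 (cscale c2 x) = cscale (c1 * c2) x.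
Proof. by rewrite /cscale cmulA ccstM. Qed.

Lemma cscale1 : left_id 1 cscale.
Proof. exact: cmul1. Qed.

Lemma cscaleDr : right_distributive cscale +%R.
Proof. by move=> c x y; exact: mulrDr. Qed.

Lemma cscaleDl x : {morph cscale^~ x : c1 c2 / c1 + c2}.
Proof. by move=> c1 c2; rewrite /cscale ccstD; exact: mulrDl. Qed.

HB.instance Definition _ := GRing.Zmodule_isLmodule.Build R (csort A)
  cscaleA cscale1 cscaleDr cscaleDl.

Lemma cinf_scalerAl c x y : c *: (x * y) = (c *: x) * y.
Proof. exact: cmulA. Qed.

End underlying_algebra.

Section morphisms.
Context {R : realType}.

Lemma cinf_morphism_cst (A B : CinfRing R) (phi : A -> B) c :
  cinf_morphism phi -> phi (ccst A c) = ccst B c.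
Proof. by move=> mphi; rewrite mphi; congr cop; apply/funext => -[]. Qed.

Lemma cinf_morphismD (A B : CinfRing R) (phi : A -> B) :
  cinf_morphism phi -> {morph phi : x y / x + y}.
Proof.
by move=> mphi x y; rewrite mphi; congr cop; apply/funext => -[[|[|//]] ?].
Qed.

Lemma cinf_morphismM (A B : CinfRing R) (phi : A -> B) :
  cinf_morphism phi -> {morph phi : x y / x * y}.
Proof.
by move=> mphi x y; rewrite mphi; congr cop; apply/funext => -[[|[|//]] ?].
Qed.

Lemma cinf_morphism_linear (A B : CinfRing R) (phi : A -> B) :
  cinf_morphism phi -> linear phi.
Proof.
move=> mphi c x y; rewrite cinf_morphismD//; congr (_ + _).
by rewrite [LHS]cinf_morphismM// cinf_morphism_cst.
Qed.

End morphisms.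

(* The free C^oo-ring on V: formal terms over V, modulo the identities that hold
   for every linear map from V to every C^oo-ring.  Sinf_universal below states
   that it is left adjoint to the forgetful functor to vector spaces. *)
Inductive cterm (R : realType) (V : Type) :=
| CVar of V
| COp m of smooth_fun R m & ('I_m -> cterm R V).

Section free_cinf_ring.
Context {R : realType}.

Fixpoint ceval (V : Type) (A : CinfRing R) (g : V -> A) (t : cterm R V) : A :=
  match t with
  | CVar v => g v
  | COp _ f a => cop f (fun i => ceval g (a i))
  end.

Context (V : lmodType R).

HB.instance Definition _ := gen_eqMixin (cterm R V).
HB.instance Definition _ := gen_choiceMixin (cterm R V).

Definition cterm_equiv (s t : cterm R V) : bool :=
  `[< forall (A : CinfRing R) (g : {linear V -> A}), ceval g s = ceval g t >].

Lemma cterm_equiv_refl : reflexive cterm_equiv.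
Proof. by move=> t; apply/asboolP. Qed.

Lemma cterm_equiv_sym : symmetric cterm_equiv.
Proof. by move=> s t; apply/asboolP/asboolP => st A g; rewrite st. Qed.

Lemma cterm_equiv_trans : transitive cterm_equiv.
Proof.
by move=> t s u /asboolP st /asboolP tu; apply/asboolP => A g; rewrite st.
Qed.

Canonical cterm_equiv_rel :=
  EquivRel cterm_equiv cterm_equiv_refl cterm_equiv_sym cterm_equiv_trans.

Definition Sinf_sort := {eq_quot cterm_equiv_rel}.

Definition Sinf_op m (f : smooth_fun R m) (x : 'I_m -> Sinf_sort) : Sinf_sort :=
  \pi_Sinf_sort (COp f (fun i => repr (x i))).

Lemma ceval_repr (A : CinfRing R) (g : {linear V -> A}) t :
  ceval g (repr (\pi_Sinf_sort t)) = ceval g t.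
Proof.
suff /asboolP : cterm_equiv (repr (\pi_Sinf_sort t)) t by exact.
by have /eqmodP := reprK (\pi_Sinf_sort t).
Qed.

Lemma Sinf_sort_ext (x y : Sinf_sort) :
  (forall (A : CinfRing R) (g : {linear V -> A}),
    ceval g (repr x) = ceval g (repr y)) -> x = y.
Proof. by move=> xy; rewrite -[x]reprK -[y]reprK; exact/eqmodP/asboolP. Qed.

Lemma Sinf_op_proj m (i : 'I_m) (x : 'I_m -> Sinf_sort) :
  Sinf_op (sf_proj i) x = x i.
Proof. by apply: Sinf_sort_ext => A g; rewrite ceval_repr/= cop_proj. Qed.

Lemma Sinf_op_comp m n (g : smooth_fun R n) (f : 'I_n -> smooth_fun R m)
    (x : 'I_m -> Sinf_sort) :
  Sinf_op (sf_comp g f) x = Sinf_op g (fun j => Sinf_op (f j) x).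
Proof.
apply: Sinf_sort_ext => A h; rewrite !ceval_repr/= cop_comp; congr cop.
by apply/funext => j; rewrite ceval_repr.
Qed.

Definition Sinf : CinfRing R := MkCinfRing Sinf_op_proj Sinf_op_comp.

Definition Sinf_eta (v : V) : Sinf := \pi_Sinf_sort (CVar R v).

Definition Sinf_ext (A : CinfRing R) (g : V -> A) (x : Sinf) : A :=
  ceval g (repr (x : Sinf_sort)).

Lemma Sinf_extE (A : CinfRing R) (g : {linear V -> A}) v :
  Sinf_ext g (Sinf_eta v) = g v.
Proof. exact: ceval_repr. Qed.

Lemma Sinf_ext_morphism (A : CinfRing R) (g : {linear V -> A}) :
  cinf_morphism (Sinf_ext g).
Proof. by move=> m f x; exact: ceval_repr. Qed.

Lemma Sinf_eta_linear : linear Sinf_eta.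
Proof.
move=> c u v; apply: Sinf_sort_ext => A g.
have lg := cinf_morphism_linear (Sinf_ext_morphism g).
rewrite -![ceval g (repr _)]/(Sinf_ext g _) lg !Sinf_extE.
exact: linearP.
Qed.

HB.instance Definition _ :=
  GRing.isLinear.Build R V (csort Sinf) *:%R Sinf_eta Sinf_eta_linear.

HB.instance Definition _ (A : CinfRing R) (g : {linear V -> A}) :=
  GRing.isLinear.Build R (csort Sinf) (csort A) *:%R (Sinf_ext g)
    (cinf_morphism_linear (Sinf_ext_morphism g)).

Theorem Sinf_universal (A : CinfRing R) (g : {linear V -> A}) :
  exists! phi : Sinf -> A,
    cinf_morphism phi /\ (forall v, phi (Sinf_eta v) = g v).
Proof.
exists (Sinf_ext g); split; first by split; [exact: Sinf_ext_morphism|exact: Sinf_extE].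
move=> phi [mphi phiE]; apply/funext => x.
rewrite -[x in RHS](reprK (x : Sinf_sort)) /Sinf_ext.
elim: (repr _) => [v|m f a IHa] /=; first by rewrite phiE.
rewrite (_ : \pi_Sinf_sort (COp f a) =
    cop (c := Sinf) f (fun i => \pi_Sinf_sort (a i))).
  by rewrite mphi; congr cop; apply/funext => i; exact: IHa.
apply: Sinf_sort_ext => B h; rewrite !ceval_repr/=; congr cop.
by apply/funext => i; rewrite ceval_repr.
Qed.

End free_cinf_ring.

(* The tensor product: formal sums of pairs (v, w), represented as lists, modulo
   the equalities that hold under every bilinear map.  The universal property is
   tensor_universal below. *)
Section tensor_product.
Context {R : realType} (V W : lmodType R).

Definition tens_eval (U : lmodType R) (b : V -> W -> U) (s : seq (V * W)) : U :=
  \sum_(p <- s) b p.1 p.2.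

Definition tens_equiv (s t : seq (V * W)) : bool :=
  `[< forall (U : lmodType R) (b : {bilinear V -> W -> U}),
        tens_eval b s = tens_eval b t >].

Lemma tens_equiv_refl : reflexive tens_equiv.
Proof. by move=> t; apply/asboolP. Qed.

Lemma tens_equiv_sym : symmetric tens_equiv.
Proof. by move=> s t; apply/asboolP/asboolP => st U b; rewrite st. Qed.

Lemma tens_equiv_trans : transitive tens_equiv.
Proof.
by move=> t s u /asboolP st /asboolP tu; apply/asboolP => U b; rewrite st.
Qed.

Canonical tens_equiv_rel :=
  EquivRel tens_equiv tens_equiv_refl tens_equiv_sym tens_equiv_trans.

Definition tensor := {eq_quot tens_equiv_rel}.

HB.instance Definition _ := Choice.on tensor.
HB.instance Definition _ := Quotient.on tensor.

Definition tlift (U : lmodType R) (b : V -> W -> U) (x : tensor) : U :=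
  tens_eval b (repr x).

Lemma tlift_pi (U : lmodType R) (b : {bilinear V -> W -> U}) s :
  tlift b (\pi_tensor s) = tens_eval b s.
Proof.
suff /asboolP : tens_equiv (repr (\pi_tensor s)) s by exact.
by have /eqmodP := reprK (\pi_tensor s).
Qed.

Lemma tensor_ext (x y : tensor) :
  (forall (U : lmodType R) (b : {bilinear V -> W -> U}), tlift b x = tlift b y) ->
  x = y.
Proof. by move=> xy; rewrite -[x]reprK -[y]reprK; exact/eqmodP/asboolP. Qed.

Definition tadd (x y : tensor) : tensor := \pi_tensor (repr x ++ repr y).
Definition tscale (c : R) (x : tensor) : tensor :=
  \pi_tensor [seq (c *: p.1, p.2) | p <- repr x].
Definition tzero : tensor := \pi_tensor [::].
Definition topp (x : tensor) : tensor := tscale (-1) x.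

Section tlift_operations.
Context (U : lmodType R) (b : {bilinear V -> W -> U}).

Lemma tlift_add x y : tlift b (tadd x y) = tlift b x + tlift b y.
Proof. by rewrite tlift_pi /tens_eval big_cat. Qed.

Lemma tlift_scale c x : tlift b (tscale c x) = c *: tlift b x.
Proof.
rewrite tlift_pi /tens_eval big_map/= scaler_sumr.
by apply: eq_bigr => p _; rewrite linearZl_LR.
Qed.

Lemma tlift_zero : tlift b tzero = 0.
Proof. by rewrite tlift_pi /tens_eval big_nil. Qed.

Lemma tlift_opp x : tlift b (topp x) = - tlift b x.
Proof. by rewrite tlift_scale scaleN1r. Qed.

End tlift_operations.

Let tlift_ops := (tlift_add, tlift_scale, tlift_zero, tlift_opp).

Lemma taddA : associative tadd.
Proof. by move=> x y z; apply: tensor_ext => U b; rewrite !tlift_ops addrA. Qed.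

Lemma taddC : commutative tadd.
Proof. by move=> x y; apply: tensor_ext => U b; rewrite !tlift_ops addrC. Qed.

Lemma tadd0 : left_id tzero tadd.
Proof. by move=> x; apply: tensor_ext => U b; rewrite !tlift_ops add0r. Qed.

Lemma taddN : left_inverse tzero topp tadd.
Proof. by move=> x; apply: tensor_ext => U b; rewrite !tlift_ops addNr. Qed.

HB.instance Definition _ := GRing.isZmodule.Build tensor taddA taddC tadd0 taddN.

Lemma tscaleA c1 c2 x : tscale c1 (tscale c2 x) = tscale (c1 * c2) x.
Proof. by apply: tensor_ext => U b; rewrite !tlift_ops scalerA. Qed.

Lemma tscale1 : left_id 1 tscale.
Proof. by move=> x; apply: tensor_ext => U b; rewrite !tlift_ops scale1r. Qed.

Lemma tscaleDr : right_distributive tscale +%R.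
Proof.
by move=> c x y; apply: tensor_ext => U b; rewrite !tlift_ops scalerDr.
Qed.

Lemma tscaleDl x : {morph tscale^~ x : c1 c2 / c1 + c2}.
Proof.
by move=> c1 c2; apply: tensor_ext => U b; rewrite !tlift_ops scalerDl.
Qed.

HB.instance Definition _ := GRing.Zmodule_isLmodule.Build R tensor
  tscaleA tscale1 tscaleDr tscaleDl.

Lemma tlift_linear (U : lmodType R) (b : {bilinear V -> W -> U}) :
  linear (tlift b).
Proof. by move=> c x y; rewrite [LHS]tlift_add [X in X + _]tlift_scale. Qed.

HB.instance Definition _ (U : lmodType R) (b : {bilinear V -> W -> U}) :=
  GRing.isLinear.Build R tensor U *:%R (tlift b) (tlift_linear b).

Definition tens (v : V) (w : W) : tensor := \pi_tensor [:: (v, w)].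

Lemma tliftE (U : lmodType R) (b : {bilinear V -> W -> U}) v w :
  tlift b (tens v w) = b v w.
Proof. by rewrite tlift_pi /tens_eval big_seq1. Qed.

Lemma tens_bilinear : bilinear_for *:%R *:%R tens.
Proof.
split=> [w c v v'|v c w w']; apply: tensor_ext => U b.
  by rewrite /= [RHS]linearP /= !tliftE linearPl.
by rewrite /= [RHS]linearP /= !tliftE linearPr.
Qed.

HB.instance Definition _ :=
  bilinear_isBilinear.Build R V W tensor *:%R *:%R tens tens_bilinear.
HB.instance Definition _ (v : V) :=
  GRing.isLinear.Build R W tensor *:%R (tens v) (tens_bilinear.2 v).

Lemma tensor_span (x : tensor) : x = \sum_(p <- repr x) tens p.1 p.2.
Proof.
apply: tensor_ext => U b; rewrite linear_sum /tlift /tens_eval.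
by apply: eq_bigr => p _; rewrite -[RHS]/(tlift b _) tliftE.
Qed.

Theorem tensor_universal (U : lmodType R) (b : {bilinear V -> W -> U}) :
  exists! f : tensor -> U, linear f /\ (forall v w, f (tens v w) = b v w).
Proof.
exists (tlift b); split; first by split; [exact: tlift_linear|exact: tliftE].
move=> f [lf fE]; apply/funext => x.
pose f' : {linear tensor -> U} := HB.pack f
  (GRing.isLinear.Build R tensor U *:%R f lf).
rewrite -[RHS]/(f' x) {2}(tensor_span x) linear_sum.
by apply: eq_bigr => p _; rewrite -fE.
Qed.

End tensor_product.

Lemma tensor_linear_ext (R : realType) (V W U : lmodType R)
    (f g : {linear tensor V W -> U}) :
  (forall v w, f (tens v w) = g (tens v w)) -> f =1 g.
Proof.
move=> fg x; rewrite (tensor_span x) !linear_sum.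
by apply: eq_bigr => p _; exact: fg.
Qed.

Notation "V \ox W" := (tensor V W) (at level 40, left associativity).

Section tensor_maps.
Context {R : realType}.
Implicit Types A B C D : lmodType R.

Lemma tens_comp_bilinear A B C D (f : {linear A -> C}) (g : {linear B -> D}) :
  bilinear_for *:%R *:%R (fun a b => tens (f a) (g b)).
Proof.
split=> [b c a a'|a c b b'] /=.
  by rewrite linearP linearPl.
by rewrite linearP linearPr.
Qed.

Definition tens_comp A B C D (f : A -> C) (g : B -> D) a b := tens (f a) (g b).
HB.instance Definition _ A B C D (f : {linear A -> C}) (g : {linear B -> D}) :=
  bilinear_isBilinear.Build R A B (C \ox D) *:%R *:%R (tens_comp f g)
    (tens_comp_bilinear f g).

Definition tensm A B C D (f : {linear A -> C}) (g : {linear B -> D}) :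
  {linear A \ox B -> C \ox D} := tlift (tens_comp f g).

Lemma tensmE A B C D (f : {linear A -> C}) (g : {linear B -> D}) a b :
  tensm f g (tens a b) = tens (f a) (g b).
Proof. exact: tliftE. Qed.

Definition tswap A B (a : A) (b : B) := tens b a.
Lemma tswap_bilinear A B : bilinear_for *:%R *:%R (@tswap A B).
Proof. by split=> [b c a a'|a c b b']; rewrite /tswap/= ?linearPl ?linearPr. Qed.
HB.instance Definition _ A B := bilinear_isBilinear.Build R A B (B \ox A)
  *:%R *:%R (@tswap A B) (@tswap_bilinear A B).
Definition tsym A B : {linear A \ox B -> B \ox A} := tlift (@tswap A B).
Lemma tsymE A B (a : A) (b : B) : tsym A B (tens a b) = tens b a.
Proof. exact: tliftE. Qed.


Definition tassocl A B C (x : A \ox B) (c : C) : A \ox (B \ox C) :=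
  tensm idfun (applyr (@tens R B C) c) x.
Lemma tassocl_bilinear A B C : bilinear_for *:%R *:%R (@tassocl A B C).
Proof.
split=> [c k x y|x k c c']; first exact: linearP.
apply: (tensor_linear_ext (f := tensm idfun (applyr (@tens R B C) (k *: c + c')))
  (g := (k \*: tensm idfun (applyr (@tens R B C) c)) \+
        tensm idfun (applyr (@tens R B C) c'))) => a b.
by rewrite /= !tensmE/= !linearPr.
Qed.
HB.instance Definition _ A B C := bilinear_isBilinear.Build R (A \ox B) C
  (A \ox (B \ox C)) *:%R *:%R (@tassocl A B C) (@tassocl_bilinear A B C).
Definition tassoc A B C : {linear (A \ox B) \ox C -> A \ox (B \ox C)} :=
  tlift (@tassocl A B C).
Lemma tassocE A B C (a : A) (b : B) (c : C) :
  tassoc A B C (tens (tens a b) c) = tens a (tens b c).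
Proof. by rewrite [LHS]tliftE /= /tassocl tensmE. Qed.

Definition tassocr A B C (a : A) (x : B \ox C) : (A \ox B) \ox C :=
  tensm (@tens R A B a) idfun x.
Lemma tassocr_bilinear A B C : bilinear_for *:%R *:%R (@tassocr A B C).
Proof.
split=> [x k a a'|a k x y]; last exact: linearP.
apply: (tensor_linear_ext (f := tensm (@tens R A B (k *: a + a')) idfun)
  (g := (k \*: tensm (@tens R A B a) idfun) \+ tensm (@tens R A B a') idfun)) => b c.
by rewrite /= !tensmE/= !linearPl.
Qed.
HB.instance Definition _ A B C := bilinear_isBilinear.Build R A (B \ox C)
  ((A \ox B) \ox C) *:%R *:%R (@tassocr A B C) (@tassocr_bilinear A B C).
Definition tassocV A B C : {linear A \ox (B \ox C) -> (A \ox B) \ox C} :=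
  tlift (@tassocr A B C).
Lemma tassocVE A B C (a : A) (b : B) (c : C) :
  tassocV A B C (tens a (tens b c)) = tens (tens a b) c.
Proof. by rewrite [LHS]tliftE /= /tassocr tensmE. Qed.

End tensor_maps.

Section unit_and_exchange.
Context {R : realType}.

Definition tlunitV (A : lmodType R) : {linear A -> R^o \ox A} :=
  @tens R R^o A 1.

Definition trunitV (A : lmodType R) : {linear A -> A \ox R^o} :=
  tsym R^o A \o tlunitV A.

(* id (x) sigma on three factors, up to associators. *)
Definition tswap23 (A B C : lmodType R) :
    {linear (A \ox B) \ox C -> (A \ox C) \ox B} :=
  tassocV A C B \o tensm idfun (tsym B C) \o tassoc A B C.

End unit_and_exchange.

(* The data of an endofunctor of R-Vec with monad and monoid structures.
   Equations use diagrammatic composition f \; g; associators and unitors are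
   written out. *)
Record modality (R : realType) := Modality {
  Sob : lmodType R -> lmodType R;
  Smap : forall V W : lmodType R, {linear V -> W} -> {linear Sob V -> Sob W};
  Smu : forall V : lmodType R, {linear Sob (Sob V) -> Sob V};
  Seta : forall V : lmodType R, {linear V -> Sob V};
  Smul : forall V : lmodType R, {linear Sob V \ox Sob V -> Sob V};
  Sone : forall V : lmodType R, {linear R^o -> Sob V} }.

Section codifferential_categories.
Context {R : realType} (M : modality R).
Local Notation S := (Sob M).
Local Notation map := (@Smap R M _ _).
Local Notation mu := (Smu M).
Local Notation eta := (Seta M).
Local Notation mul := (Smul M).
Local Notation one := (Sone M).
Implicit Types V W C B : lmodType R.

Record is_monad : Prop := {
  Smap_id : forall V, map (idfun : {linear V -> V}) =1 idfun;
  Smap_comp : forall (V W X : lmodType R) (f : {linear V -> W}) (g : {linear W -> X}),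
    map (g \o f) =1 map f \; map g;
  Seta_natural : forall V W (f : {linear V -> W}),
    f \; eta W =1 eta V \; map f;
  Smu_natural : forall V W (f : {linear V -> W}),
    map (map f) \; mu W =1 mu V \; map f;
  Smu_etal : forall V, eta (S V) \; mu V =1 idfun;
  Smu_etar : forall V, map (eta V) \; mu V =1 idfun;
  Smu_assoc : forall V, map (mu V) \; mu V =1 mu (S V) \; mu V }.

Record is_algebra_modality : Prop := {
  am_monad : is_monad;
  Smul_natural : forall V W (f : {linear V -> W}),
    tensm (map f) (map f) \; mul W =1 mul V \; map f;
  Sone_natural : forall V W (f : {linear V -> W}), one V \; map f =1 one W;
  Smul_assoc : forall V,
    tensm (mul V) idfun \; mul V
      =1 tassoc (S V) (S V) (S V) \; tensm idfun (mul V) \; mul V;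
  Smul_onel : forall V, tlunitV (S V) \; tensm (one V) idfun \; mul V =1 idfun;
  Smul_oner : forall V, trunitV (S V) \; tensm idfun (one V) \; mul V =1 idfun;
  Smul_comm : forall V, tsym (S V) (S V) \; mul V =1 mul V;
  Smu_mul : forall V, mul (S V) \; mu V =1 tensm (mu V) (mu V) \; mul V;
  Smu_one : forall V, one (S V) \; mu V =1 one V }.

Record is_deriving (d : forall C, {linear S C -> S C \ox C}) : Prop := {
  d_natural : forall V W (f : {linear V -> W}),
    map f \; d W =1 d V \; tensm (map f) f;
  d_one : forall C, one C \; d C =1 \0;
  d_mul : forall C,
    mul C \; d C
      =1 (tensm idfun (d C) \; tassocV (S C) (S C) C \; tensm (mul C) idfun)
         \+ (tensm (d C) idfun \; tswap23 (S C) C (S C)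
             \; tensm (mul C) idfun);
  d_eta : forall C, eta C \; d C =1 tlunitV C \; tensm (one C) idfun;
  d_mu : forall C,
    mu C \; d C
      =1 d (S C) \; tensm (mu C) (d C) \; tassocV (S C) (S C) C
         \; tensm (mul C) idfun;
  d_d : forall C,
    d C \; tensm (d C) idfun
      =1 d C \; tensm (d C) idfun \; tswap23 (S C) C C }.

Record is_integral (s : forall C, {linear S C \ox C -> S C}) : Prop := {
  s_natural : forall V W (f : {linear V -> W}),
    tensm (map f) f \; s W =1 s V \; map f;
  s_one : forall C, tlunitV C \; tensm (one C) idfun \; s C =1 eta C;
  s_mul : forall C,
    tensm (s C) (s C) \; mul C
      =1 (tensm (s C) idfun \; tassocV (S C) (S C) C
          \; tensm (mul C) idfun \; s C)
         \+ (tensm idfun (s C) \; tswap23 (S C) C (S C)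
             \; tensm (mul C) idfun \; s C);
  s_s : forall C,
    tensm (s C) idfun \; s C
      =1 tswap23 (S C) C C \; tensm (s C) idfun \; s C }.

Definition is_codifferential (d : forall C, {linear S C -> S C \ox C}) : Prop :=
  is_algebra_modality /\ is_deriving d.

Definition is_cointegral (s : forall C, {linear S C \ox C -> S C}) : Prop :=
  is_algebra_modality /\ is_integral s.

Record is_cocalculus (d : forall C, {linear S C -> S C \ox C})
    (s : forall C, {linear S C \ox C -> S C}) : Prop := {
  cc_codifferential : is_codifferential d;
  cc_cointegral : is_cointegral s;
  cc_ftc2 : forall C, (d C \; s C) \+ map (\0 : {linear C -> C}) =1 idfun;
  cc_poincare : forall B C (f : {linear B -> S C \ox C}),
    f \; tensm (d C) idfun \; tswap23 (S C) C C =1 f \; tensm (d C) idfun ->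
    f \; s C \; d C =1 f }.

Definition coderiving C : {linear S C \ox C -> S C} :=
  mul C \o tensm idfun (eta C).

Definition Ltrans (d : forall C, {linear S C -> S C \ox C}) C :
    {linear S C -> S C} :=
  coderiving C \o d C.

Definition Ktrans (d : forall C, {linear S C -> S C \ox C}) C :
    {linear S C -> S C} :=
  Ltrans d C \+ map (\0 : {linear C -> C}).

Definition is_natural_inverse (K K' : forall C, {linear S C -> S C}) : Prop :=
  [/\ forall V W (f : {linear V -> W}), map f \; K' W =1 K' V \; map f,
      forall C, K C \; K' C =1 idfun
    & forall C, K' C \; K C =1 idfun].

Definition has_antiderivatives (d : forall C, {linear S C -> S C \ox C}) : Prop :=
  exists K', is_natural_inverse (Ktrans d) K'.

End codifferential_categories.

Arguments coderiving {R} M C.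
Arguments Ltrans {R} M d C.
Arguments Ktrans {R} M d C.
Arguments is_deriving {R} M d.
Arguments is_integral {R} M s.
Arguments is_codifferential {R} M d.
Arguments is_cointegral {R} M s.
Arguments is_cocalculus {R} M d s.
Arguments is_natural_inverse {R} M K K'.
Arguments has_antiderivatives {R} M d.

Section free_cinf_monad.
Context {R : realType}.

Definition Sinf_ob (V : lmodType R) : lmodType R := Sinf V.

Definition Sinf_map (V W : lmodType R) (f : {linear V -> W}) :
    {linear Sinf_ob V -> Sinf_ob W} :=
  Sinf_ext (@Sinf_eta R W \o f).

Definition Sinf_mu (V : lmodType R) :
    {linear Sinf_ob (Sinf_ob V) -> Sinf_ob V} :=
  Sinf_ext (idfun : {linear Sinf V -> Sinf V}).

Lemma cinf_mul_bilinear (A : CinfRing R) :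
  bilinear_for *:%R *:%R (@GRing.mul A : A -> A -> A).
Proof.
split=> [z c x y|z c x y] /=; first by rewrite mulrDl cinf_scalerAl.
by rewrite mulrDr ![z * _]mulrC cinf_scalerAl.
Qed.

HB.instance Definition _ (A : CinfRing R) := bilinear_isBilinear.Build R
  (csort A) (csort A) (csort A) *:%R *:%R (@cmul R A) (cinf_mul_bilinear A).

Definition Sinf_mul (V : lmodType R) :
    {linear Sinf_ob V \ox Sinf_ob V -> Sinf_ob V} :=
  tlift (@cmul R (Sinf V)).

Definition cinf_unit (A : CinfRing R) (c : R^o) : A := c *: (1 : A).

Lemma cinf_unit_linear (A : CinfRing R) : linear (@cinf_unit A).
Proof. by move=> c x y; rewrite /cinf_unit scalerDl scalerA. Qed.

HB.instance Definition _ (A : CinfRing R) :=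
  GRing.isLinear.Build R R^o (csort A) *:%R (@cinf_unit A) (@cinf_unit_linear A).

Definition Sinf_one (V : lmodType R) : {linear R^o -> Sinf_ob V} :=
  @cinf_unit (Sinf V).

Definition Sinf_modality : modality R :=
  Modality Sinf_map Sinf_mu (fun V => @Sinf_eta R V) Sinf_mul Sinf_one.

(* f |-> Phi_f(eta e_1, ..., eta e_n), the identification of C^oo(R^n) with the
   free C^oo-ring on R^n (Sinf_of_smooth_bij, Sinf_of_smooth_morphism); it sends
   the i-th coordinate function to eta e_i. *)
Definition Sinf_of_smooth n (f : smooth_fun R n) : Sinf_ob 'rV[R]_n :=
  cop (c := Sinf 'rV[R]_n) f (fun i => Sinf_eta 'e_i).

Lemma sf_comp_proj n (i : 'I_n) m (f : 'I_n -> smooth_fun R m) :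
  sf_comp (sf_proj i) f = f i.
Proof. by apply: sfun_ext => x /=; rewrite mxE. Qed.

Lemma sf_compA k m n (h : smooth_fun R n) (g : 'I_n -> smooth_fun R m)
    (f : 'I_m -> smooth_fun R k) :
  sf_comp (sf_comp h g) f = sf_comp h (fun j => sf_comp (g j) f).
Proof. exact: sfun_ext. Qed.

Definition Cinf_Rn n : CinfRing R := @MkCinfRing R (smooth_fun R n)
  (fun m (g : smooth_fun R m) f => sf_comp g f)
  (fun m i f => sf_comp_proj i f) (fun m k g f h => sf_compA g f h).

Definition coords n (v : 'rV[R]_n) : Cinf_Rn n :=
  \sum_(i < n) v 0 i *: (sf_proj i : Cinf_Rn n).

Lemma coords_linear n : linear (@coords n).
Proof.
move=> c u v; rewrite /coords scaler_sumr -big_split/=; apply: eq_bigr => i _.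
by rewrite !mxE scalerDl scalerA.
Qed.

HB.instance Definition _ n := GRing.isLinear.Build R 'rV[R]_n (csort (Cinf_Rn n))
  *:%R (@coords n) (@coords_linear n).

Lemma coords_e n (i : 'I_n) : coords 'e_i = sf_proj i :> Cinf_Rn n.
Proof.
rewrite /coords (bigD1 i)//= mxE !eqxx scale1r big1 ?addr0// => j ji.
by rewrite mxE (negbTE ji) andbF scale0r.
Qed.

Lemma Sinf_of_smooth_morphism n :
  @cinf_morphism R (Cinf_Rn n) (Sinf 'rV[R]_n) (@Sinf_of_smooth n).
Proof. by move=> m f x; rewrite /Sinf_of_smooth [LHS]cop_comp. Qed.

Theorem Sinf_of_smooth_bij n : bijective (@Sinf_of_smooth n).
Proof.
exists (@Sinf_ext R 'rV[R]_n (Cinf_Rn n) (@coords n)) => [f|x].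
  rewrite [LHS]Sinf_ext_morphism (_ : _ \o _ = @sf_proj R n); last first.
    by apply/funext => i; rewrite [LHS]Sinf_extE; exact: coords_e.
  apply: sfun_ext => v /=; congr (f _).
  by apply/rowP => j; rewrite mxE.
have [phi [_ phi_uniq]] := Sinf_universal (@Sinf_eta R 'rV[R]_n).
have phi1 := phi_uniq idfun; have phi2 := phi_uniq (@Sinf_of_smooth n \o
  @Sinf_ext R 'rV[R]_n (Cinf_Rn n) (@coords n)).
rewrite -[LHS]/((@Sinf_of_smooth n \o
  @Sinf_ext R 'rV[R]_n (Cinf_Rn n) (@coords n)) x) -phi2 ?phi1//.
split=> [m f y|v] /=.
  by rewrite [in LHS]Sinf_ext_morphism [LHS]Sinf_of_smooth_morphism.
rewrite [in LHS]Sinf_extE.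
pose lin : {linear Cinf_Rn n -> Sinf 'rV[R]_n} := HB.pack (@Sinf_of_smooth n)
  (GRing.isLinear.Build R (csort (Cinf_Rn n)) (csort (Sinf 'rV[R]_n)) *:%R
    (@Sinf_of_smooth n) (cinf_morphism_linear (@Sinf_of_smooth_morphism n))).
rewrite -[LHS]/(lin _) linear_sum [in RHS](row_sum_delta v) linear_sum.
apply: eq_bigr => i _; rewrite !linearZ; congr (_ *: _).
exact: (@cop_proj R (Sinf 'rV[R]_n)).
Qed.

Definition is_Sinf_deriving
    (d : forall V : lmodType R, {linear Sinf_ob V -> Sinf_ob V \ox V}) : Prop :=
  (forall (V W : lmodType R) (f : {linear V -> W}),
     Sinf_map f \; d W =1 d V \; tensm (Sinf_map f) f) /\
  (forall n (f : smooth_fun R n),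
     d 'rV[R]_n (Sinf_of_smooth f) =
     \sum_(i < n) tens (Sinf_of_smooth (sf_partial i f)) 'e_i).

End free_cinf_monad.


Arguments Sinf_modality R : clear implicits.

(* Main.v *)
(* Let d be the C^oo-derivation classified by the square-zero extension of the free
   C^oo-ring S V by S V (x) V; it is determined by its values on R^n, because every
   element of S V lives on a finite-dimensional retract of V.  The symmetry of second
   derivatives gives [d.5], the chain rule [d.4].

   L = d d° is the Euler operator sum x_i d/dx_i, a derivation of S V that fixes the
   generators; so L (d° y) = d° ((1 + L) (x) 1) y.  On C^oo(R^n), 1 + L is invertible, with
   inverse the ray average A f (x) = int_0^1 f (t x) dt, and L f = 0 forces f = f(0);
   both facts pass to S V through the finite-dimensional retracts.  Elements of S V
   are therefore separated by L and S(0), and all the identities reduce to applying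
   L and S(0) to both sides: s = (A (x) 1) d°, and K^-1 = d (A (x) 1) s + S(0).
   For closed w one has d (d° w) = ((1 + L) (x) 1) w, whence d (s w) = w. *)
From HB Require Import structures.
Require Import Defs.
From mathcomp Require Import all_boot all_order all_algebra.
From mathcomp Require Import all_classical all_reals all_analysis.
From mathcomp Require Import ring lra.
Set Implicit Arguments.
Unset Strict Implicit.
Unset Printing Implicit Defensive.
Import Order.TTheory GRing.Theory Num.Theory numFieldNormedType.Exports.
Local Open Scope classical_set_scope.
Local Open Scope quotient_scope.
Local Open Scope ring_scope.

(** * Symmetry of second derivatives *)

Section lines.
Context {R : realType} {n : nat}.
Implicit Types (f g : 'rV[R]_n -> R) (a h x : 'rV[R]_n) (s t : R).

Lemma diff_partial f x h :
  differentiable f x -> 'd f x h = \sum_i h 0 i * partial i f x.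
Proof.
move=> df; rewrite {1}(row_sum_delta h) linear_sum; apply: eq_bigr => i _.
by rewrite linearZ -deriveE.
Qed.

Lemma is_derive_line f a h s : differentiable f (a + s *: h) ->
  is_derive s 1 (fun t => f (a + t *: h)) (\sum_i h 0 i * partial i f (a + s *: h)).
Proof.
move=> df; have dl : is_diff s (fun t : R => a + t *: h) (fun t => 0 + t *: h).
  exact: is_diffD.
have dc := is_diff_comp dl (differentiableP df).
have dd : differentiable (fun t => f (a + t *: h)) s by case: dc.
apply: DeriveDef; first exact/derivable1_diffP.
have dE := @diff_val _ _ _ _ _ _ _ dc.
by rewrite deriveE// [LHS](congr1 (@^~ (1 : R)) dE)/= add0r scale1r diff_partial.
Qed.

Lemma line_MVT f a h : (forall x, differentiable f x) ->
  exists2 s, 0 < s < 1 & f (a + h) - f a = \sum_i h 0 i * partial i f (a + s *: h).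
Proof.
move=> df; have ddf s := is_derive_line (df (a + s *: h)).
have [|s s01] := @MVT R (fun t => f (a + t *: h)) _ 0 1 ltr01 (fun s _ => ddf s).
  by apply: derivable_within_continuous => s _; case: (ddf s).
by rewrite scale1r scale0r addr0 subr0 mulr1 => fE; exists s.
Qed.

(** Compactness of [0, 1] makes the choice of [d] uniform in [t]: near each [t], both
    [f (s *: x + h)] and [f (s *: x)] are within [e / 2] of [f (t *: x)], and a near-covering
    argument glues these neighbourhoods. *)
Lemma continuous_near_segment f x (e : R) : continuous f -> 0 < e ->
  exists2 d : R, 0 < d & forall h t, `|h| < d -> 0 <= t <= 1 ->
    `|f (t *: x + h) - f (t *: x)| < e.
Proof.
move=> cf e0.
pose P h t := `|f (t *: x + h) - f (t *: x)| < e.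
have e20 : 0 < e / 2 by rewrite divr_gt0.
have : \forall h \near (0 : 'rV[R]_n), `[0, 1]%classic `<=` P h.
  have /compact_near_coveringP/(_ _ (nbhs (0 : 'rV[R]_n)) P _) := @segment_compact R 0 1.
  apply=> t _.
  have /cvgrPdist_lt/(_ _ e20) fh :
     (fun th : R * 'rV[R]_n => f (th.1 *: x + th.2)) @ (t, 0 : 'rV[R]_n) --> f (t *: x).
    rewrite -[t *: x]addr0.
    apply: (continuous_comp (f := fun th : R * 'rV[R]_n => th.1 *: x + th.2));
      last exact: cf.
    apply: cvgD; last exact: cvg_snd.
    by apply: cvgZr_tmp; exact: cvg_fst.
  have /cvgrPdist_lt/(_ _ e20) f0 :
     (fun th : R * 'rV[R]_n => f (th.1 *: x)) @ (t, 0 : 'rV[R]_n) --> f (t *: x).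
    apply: (continuous_comp (f := fun th : R * 'rV[R]_n => th.1 *: x)); last exact: cf.
    by apply: cvgZr_tmp; exact: cvg_fst.
  apply: filterS2 fh f0 => -[s h] /= fh f0.
  rewrite /P -(subrKA (f (t *: x))) (le_lt_trans (ler_normD _ _))// (splitr e) ltrD//.
  by rewrite distrC.
move=> /nbhs_ballP[d d0 dP]; exists d => // h t hd t01.
by apply: dP => //; rewrite -ball_normE /= sub0r normrN.
Qed.

Lemma coord_le_norm x i : `|x 0 i| <= `|x|.
Proof.
rewrite [leRHS]/Num.norm /= mx_normrE.
exact: (le_bigmax _ (fun ij => `|x ij.1 ij.2|) (0, i)).
Qed.

Lemma norm_delta_le1 (i : 'I_n) : `|'e_i : 'rV[R]_n| <= 1.
Proof.
rewrite [leLHS]/Num.norm /= mx_normrE; apply: bigmax_le => // -[k j] _ /=.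
by rewrite !mxE; case: eqP; case: eqP; rewrite ?normr1 ?normr0.
Qed.

Lemma half_dist (a b c e : R) :
  `|c - a| < e / 2 -> `|c - b| < e / 2 -> `|a - b| <= e.
Proof.
rewrite distrC => ca cb; rewrite -(subrKA c) (le_trans (ler_normD _ _))//.
by rewrite [leRHS](splitr e); apply: lerD; exact: ltW.
Qed.

Lemma quarter_lt (a : R) : 0 < a / 4 -> a / 4 *+ 2 < a.
Proof. lra. Qed.

Lemma partialC f i j : Ck 2 f -> partial i (partial j f) = partial j (partial i f).
Proof.
move=> cf.
(* Both mixed partials are limits of one second difference quotient, which is
   symmetric in the two directions; MVT is applied in one order, then the other. *)
have sd (k l : 'I_n) x d : 0 < d -> exists2 h, `|h| <= d *+ 2 &
   f (x + d *: 'e_l + d *: 'e_k) - f (x + d *: 'e_k) - (f (x + d *: 'e_l) - f x)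
   = d ^+ 2 * partial l (partial k f) (x + h).
  move=> d0; have df y : differentiable f y by exact: CkS_diff cf.
  have dkf y : differentiable (partial k f) y by exact: CkS_diff (CkS_partial k cf).
  have d_e (m : 'I_n) (g : 'I_n -> R) : \sum_i (d *: 'e_m) 0 i * g i = d * g m.
    rewrite (bigD1 m)//= big1 => [|p /negPf pm]; last by rewrite !mxE pm andbF mulr0 mul0r.
    by rewrite !mxE !eqxx mulr1 addr0.
  have small (m : 'I_n) t : 0 < t < 1 -> `|t *: (d *: 'e_m : 'rV[R]_n)| <= d.
    move=> /andP[t0 t1]; rewrite !normrZ !gtr0_norm// -[leRHS]mulr1 mulrCA.
    by rewrite ler_pM2l// mulr_ile1 ?norm_delta_le1 ?normr_ge0// ltW.
  pose g t := f (x + d *: 'e_l + t *: (d *: 'e_k)) - f (x + t *: (d *: 'e_k)).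
  have dg t : is_derive t 1 g (d * (partial k f (x + d *: 'e_l + t *: (d *: 'e_k)) -
      partial k f (x + t *: (d *: 'e_k)))).
    rewrite mulrBr; have := is_derive_line (df (x + t *: (d *: 'e_k))).
    have := is_derive_line (df (x + d *: 'e_l + t *: (d *: 'e_k))).
    by rewrite !d_e => d1 d2; exact: is_deriveB.
  have [|s s01] := @MVT R g _ 0 1 ltr01 (fun s _ => dg s).
    by apply: derivable_within_continuous => s _; case: (dg s).
  rewrite /g !scale1r !scale0r !addr0 subr0 mulr1 => ->.
  rewrite [x + d *: 'e_l + _]addrAC.
  have [t t01 ->] := line_MVT (x + s *: (d *: 'e_k)) (d *: 'e_l) dkf.
  rewrite d_e mulrA; exists (s *: (d *: 'e_k) + t *: (d *: 'e_l)); last by rewrite addrA.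
  by rewrite (le_trans (ler_normD _ _))// mulr2n lerD//; apply: small.
apply/funext => x; apply/eqP; rewrite -subr_eq0 -normr_le0; apply/ler_addgt0Pr => e e0.
rewrite add0r.
have e20 : 0 < e / 2 by rewrite divr_gt0.
have [d1 d10 near1] := continuous_near_segment x (CkS_partial i (CkS_partial j cf)) e20.
have [d2 d20 near2] := continuous_near_segment x (CkS_partial j (CkS_partial i cf)) e20.
(* The displacements supplied by [sd] have norm at most [d *+ 2]; the factor 4 keeps them strictly
   below both radii. *)
pose d := Num.min d1 d2 / 4.
have d0 : 0 < d by rewrite divr_gt0// lt_min d10.
have [h hd hE] := sd i j x d d0.
have [k kd kE] := sd j i x d d0.
have {hE kE} : partial j (partial i f) (x + h) = partial i (partial j f) (x + k).
  have swap (a b c u : R) : a - b - (c - u) = a - c - (b - u) by ring.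
  apply: (mulfI (expf_neq0 2 (lt0r_neq0 d0))); apply: etrans (esym hE) (etrans _ kE).
  by rewrite [x + _ + _]addrAC; exact: swap.
move=> hk; have /quarter_lt := d0; rewrite lt_min => /andP[dd1 dd2].
have := near1 k 1 (le_lt_trans kd dd1); have := near2 h 1 (le_lt_trans hd dd2).
rewrite !scale1r ler01 lexx hk => /(_ isT) nh /(_ isT) nk.
exact: half_dist nk nh.
Qed.

End lines.

(** * Averages along rays *)

Section ray_average.
Context {R : realType}.
Local Notation mu := (@lebesgue_measure R).
Local Notation "\int01 h" := (\int[mu]_(t in `[0, 1]) h t)%R (at level 36).

Lemma integrable01 (h : R -> R) : continuous h -> mu.-integrable `[0, 1] (EFin \o h).
Proof.
move=> ch; apply: continuous_compact_integrable; first exact: segment_compact.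
exact: continuous_subspaceT.
Qed.
Hint Resolve integrable01 : core.

Lemma int01_norm_le (h : R -> R) (e : R) : continuous h ->
  (forall t, 0 <= t <= 1 -> `|h t| <= e) -> `|\int01 h| <= e.
Proof.
move=> ch he; apply: (le_trans (le_normr_Rintegral _ _)) => //; first exact: integrable01.
have -> : e = \int01 (cst e).
  by rewrite Rintegral_cst//= lebesgue_measure_itv/= lte_fin ltr01 oppr0 adde0 mulr1.
apply: le_Rintegral => //.
- apply: integrable01 => t; apply: continuous_comp; [exact: ch|exact: norm_continuous].
- by apply: integrable01 => t; exact: cvg_cst.
Qed.

Lemma continuous_subr (u v : R -> R) :
  continuous u -> continuous v -> continuous (fun t => u t - v t).
Proof. by move=> cu cv t; exact: (continuousB (cu t) (cv t)). Qed.

Lemma continuous_sumr n (u : 'I_n -> R -> R) :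
  (forall i, continuous (u i)) -> continuous (fun t => \sum_(i < n) u i t).
Proof.
elim: n u => [|n IHn] u cu.
  by under eq_fun do rewrite big_ord0; move=> t; exact: cvg_cst.
under eq_fun do rewrite big_ord_recl; move=> t.
exact: (continuousD (cu ord0 t) (IHn _ (fun i => cu (lift ord0 i)) t)).
Qed.

Lemma int01_sum n (u : 'I_n -> R -> R) :
  (forall i, continuous (u i)) ->
  \int01 (fun t => \sum_(i < n) u i t) = \sum_(i < n) \int01 (u i).
Proof.
elim: n u => [|n IHn] u cu.
  rewrite big_ord0; under eq_Rintegral do rewrite big_ord0.
  by rewrite Rintegral_cst// mul0r.
rewrite big_ord_recl -IHn//; under eq_Rintegral do rewrite big_ord_recl.
rewrite RintegralD//; first exact: integrable01.
by apply: integrable01; exact: continuous_sumr.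
Qed.

Context {n : nat}.
Implicit Types (f : 'rV[R]_n -> R) (x h : 'rV[R]_n) (k : nat).

(** The weight makes the family closed under differentiation: each partial derivative of
    [f (t *: x)] brings out a factor [t], so [k] rises by one. The ray average itself is the case
    [k = 0]. *)
Definition ravg k f x : R := \int01 (fun t => t ^+ k * f (t *: x)).

Lemma ravg_integrand_continuous k f x : continuous f ->
  continuous (fun t : R => t ^+ k * f (t *: x)).
Proof.
move=> cf t.
apply: (continuousM (s := fun t : R => t ^+ k) (t := fun t : R => f (t *: x))).
  exact: exprn_continuous.
apply: (continuous_comp (f := fun s : R => s *: x)); last exact: cf.
exact: scalel_continuous.
Qed.

Lemma ravg_continuous k f : continuous f -> continuous (ravg k f).
Proof.
move=> cf x; apply/(@cvgrPdist_le _ _ _ (nbhs x)) => e e0.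
have [d d0 near] := continuous_near_segment x cf e0.
apply/nbhs_ballP; exists d => // y; rewrite -ball_normE/= => xy.
rewrite /ravg -RintegralB//; try by apply: integrable01; exact: ravg_integrand_continuous.
apply: int01_norm_le => [|t t01].
  by apply: continuous_subr; exact: ravg_integrand_continuous.
rewrite -mulrBr normrM distrC.
have := near (t *: (y - x)) t _ t01; rewrite scalerBr subrKC => nearx.
have /andP[t0 t1] := t01.
rewrite -[leRHS]mul1r ler_pM// ?normr_ge0//.
  by rewrite ger0_norm ?exprn_ge0// exprn_ile1.
rewrite ltW// nearx// -scalerBr normrZ ger0_norm// distrC.
by rewrite (le_lt_trans _ xy)// ler_piMl.
Qed.

(** Differentiation under the integral sign, done by hand: for each [t] the mean value theorem from
    [t *: x] along [t *: h] gives the increment of the integrand, and uniform continuity of the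
    partials near the segment bounds its distance from the linear term. *)
Lemma ravg_expansion k f x (e : R) : (forall y, differentiable f y) ->
  (forall i, continuous (partial i f)) -> 0 < e ->
  exists2 d : R, 0 < d & forall h, `|h| < d ->
  `|ravg k f (x + h) - ravg k f x - \sum_i h 0 i * ravg k.+1 (partial i f) x|
    <= e * `|h|.
Proof.
(* Each of the [n] coordinates costs at most [e' * |h|]; dividing by [n.+1] also covers dimension
   0. *)
move=> df cf e0; pose e' := e / n.+1%:R.
have e'0 : 0 < e' by rewrite divr_gt0// ltr0n.
have /choice[d dP] : forall i, exists d : R, 0 < d /\ forall h t, `|h| < d ->
    0 <= t <= 1 -> `|partial i f (t *: x + h) - partial i f (t *: x)| < e'.
  by move=> i; have [d] := continuous_near_segment x (cf i) e'0; exists d.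
exists (\big[Num.min/1]_i d i) => [|h hd].
  by apply: lt_bigmin => // i _; case: (dP i).
have cf0 : continuous f by move=> y; exact/differentiable_continuous.
pose F t := t ^+ k * f (t *: (x + h)) - t ^+ k * f (t *: x) -
  \sum_i h 0 i * (t ^+ k.+1 * partial i f (t *: x)).
have cS i : continuous (fun t : R => h 0 i * (t ^+ k.+1 * partial i f (t *: x))).
  move=> t; apply: (continuousM (s := cst (h 0 i))
    (t := fun t : R => t ^+ k.+1 * partial i f (t *: x))); first exact: cst_continuous.
  exact: ravg_integrand_continuous.
have cB : continuous (fun t : R => t ^+ k * f (t *: (x + h)) - t ^+ k * f (t *: x)).
  by apply: continuous_subr; exact: ravg_integrand_continuous.
have -> : ravg k f (x + h) - ravg k f x - \sum_i h 0 i * ravg k.+1 (partial i f) x =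
    \int01 F.
  rewrite RintegralB//; [|exact: integrable01|by apply: integrable01; exact: continuous_sumr].
  rewrite int01_sum// RintegralB//;
    try by apply: integrable01; exact: ravg_integrand_continuous.
  congr (_ - _); apply: eq_bigr => i _; rewrite RintegralZl//.
  by apply: integrable01; exact: ravg_integrand_continuous.
apply: int01_norm_le => [|t /andP[t0 t1]].
  by apply: continuous_subr => //; exact: continuous_sumr.
rewrite /F -mulrBr scalerDr.
have [s /andP[s0 s1] ->] := line_MVT (t *: x) (t *: h) df.
rewrite mulr_sumr -sumrB (le_trans (ler_norm_sum _ _ _))//.
have -> : e * `|h| = \sum_(i < n.+1) e' * `|h|.
  by rewrite sumr_const card_ord -mulrnAl /e' -[_ *+ _]mulr_natr divfK ?pnatr_eq0.
rewrite big_ord_recl /= -[leLHS]add0r; apply: lerD; first by rewrite mulr_ge0// ltW.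
apply: ler_sum => i _; rewrite mxE.
have -> : t ^+ k * (t * h 0 i * partial i f (t *: x + s *: (t *: h))) -
  h 0 i * (t ^+ k.+1 * partial i f (t *: x)) =
  t ^+ k.+1 * (partial i f (t *: x + s *: (t *: h)) - partial i f (t *: x)) * h 0 i.
  by rewrite exprS; ring.
rewrite normrM ler_pM ?coord_le_norm// normrM -[leRHS]mul1r ler_pM//.
  by rewrite ger0_norm ?exprn_ge0// exprn_ile1.
rewrite ltW//; have [_ ->//] := dP i; last by rewrite t0 t1.
have : \big[Num.min/1]_i d i <= d i by exact: bigmin_le.
apply: lt_le_trans; apply: le_lt_trans hd.
rewrite scalerA normrZ ler_piMl// ger0_norm ?mulr_ge0 ?(ltW s0)//.
by rewrite mulr_ile1 ?(ltW s0)// ltW.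
Qed.

Lemma ravg_differentiable k f x : (forall y, differentiable f y) ->
  (forall i, continuous (partial i f)) ->
  differentiable (ravg k f) x /\
  'd (ravg k f) x = (fun h => \sum_i h 0 i * ravg k.+1 (partial i f) x) :> (_ -> _).
Proof.
move=> df cf.
pose g h := \sum_i h 0 i * ravg k.+1 (partial i f) x.
have lg : linear g.
  move=> c u v; rewrite /g scaler_sumr -big_split/=; apply: eq_bigr => i _.
  by rewrite !mxE mulrDl scalerAl.
pose g' : {linear 'rV[R]_n -> R} := HB.pack g (GRing.isLinear.Build _ _ _ _ g lg).
have cg : continuous g'.
  by apply: (Ck_sum (k := 0)) => i; apply: CkM; [exact: Ck_coord|exact: Ck_cst].
have gE : ravg k f \o shift x = cst (ravg k f x) + g' +o_ (0 : 'rV[R]_n) id.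
  apply/eqaddoP => e e0; have [d d0 dP] := ravg_expansion k x df cf e0.
  apply/nbhs_ballP; exists d => // h; rewrite -ball_normE/= sub0r normrN => hd.
  by rewrite !fctE /= opprD addrA [h + x]addrC; exact: dP.
have dE := diff_unique cg gE; split; last exact: dE.
by apply/diff_locallyP; rewrite dE.
Qed.

Lemma partial_ravg k f i : (forall y, differentiable f y) ->
  (forall i, continuous (partial i f)) ->
  partial i (ravg k f) = ravg k.+1 (partial i f).
Proof.
move=> df cf; apply/funext => x; have [dr dE] := ravg_differentiable k x df cf.
rewrite [LHS]deriveE// dE (bigD1 i)//= big1 => [|j /negPf ji]; last first.
  by rewrite mxE ji andbF mul0r.
by rewrite mxE !eqxx mul1r addr0.
Qed.

(** The induction on [j] must leave [k] free, since [partial_ravg] raises it. *)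
Lemma Ck_ravg j k f : Ck j f -> Ck j (ravg k f).
Proof.
elim: j k f => [|j IHj] k f cf; first exact: ravg_continuous.
have df y : differentiable f y by exact: CkS_diff cf.
have cpf i : continuous (partial i f).
  by elim: (j) (CkS_partial i cf) => [//|l IHl] /CkW.
split=> [x|i]; first by have [] := ravg_differentiable k x df cpf.
by rewrite partial_ravg//; apply: IHj; exact: CkS_partial.
Qed.

(** The derivative found here is [(1 + L) f] at [t *: x]. Integrating it over [0, 1] shows that the
    ray average inverts [1 + L]; the mean value theorem applied to it gives injectivity. *)
Lemma is_derive_ray f x (t : R) : (forall y, differentiable f y) ->
  is_derive t 1 (fun s => s * f (s *: x))
    (f (t *: x) + \sum_i (t *: x) 0 i * partial i f (t *: x)).
Proof.
move=> df; have dr : is_derive t 1 (fun s => f (s *: x))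
    (\sum_i x 0 i * partial i f (t *: x)).
  rewrite (_ : (fun s => _) = fun s => f (0 + s *: x)); last first.
    by apply/funext => s; rewrite add0r.
  by rewrite -[t *: x]add0r; apply: is_derive_line.
have := is_deriveM (is_derive_id t 1) dr.
rewrite addrC [_%:A]mulr1 (_ : t *: _ = \sum_i (t *: x) 0 i * partial i f (t *: x))//.
by rewrite scaler_sumr; apply: eq_bigr => i _; rewrite mxE [LHS]mulrA.
Qed.

Lemma euler_ravg f x : (forall y, differentiable f y) ->
  (forall i, continuous (partial i f)) ->
  ravg 0 f x + \sum_i x 0 i * partial i (ravg 0 f) x = f x.
Proof.
move=> df cf; under eq_bigr do rewrite partial_ravg//.
have cf0 : continuous f by move=> y; exact/differentiable_continuous.
have dr t := is_derive_ray x t df.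
have cr : continuous (fun t : R => t * f (t *: x)).
  by move=> t; apply/differentiable_continuous/derivable1_diffP; case: (dr t).
have cp i : continuous (fun t : R => x 0 i * (t ^+ 1 * partial i f (t *: x))).
  move=> t; apply: (continuousM (s := cst (x 0 i))
    (t := fun t : R => t ^+ 1 * partial i f (t *: x))); first exact: cst_continuous.
  exact: ravg_integrand_continuous.
have cp0 := @ravg_integrand_continuous 0 f x cf0.
have cs := continuous_sumr cp.
(* Gathered under one integral, the left-hand side integrates the derivative of [t * f (t *: x)],
   whose values at 0 and 1 are 0 and [f x]. *)
transitivity (\int01 (fun t => t ^+ 0 * f (t *: x) +
    \sum_i x 0 i * (t ^+ 1 * partial i f (t *: x)))).
  rewrite RintegralD ?int01_sum//; try exact: integrable01.
  congr (_ + _); apply: eq_bigr => i _; rewrite RintegralZl//.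
  by apply: integrable01; exact: ravg_integrand_continuous.
rewrite /Rintegral (@continuous_FTC2 _ _ (fun t => t * f (t *: x)) _ _ ltr01) /=.
- by rewrite scale1r mul1r mul0r subr0.
- by apply: continuous_subspaceT => t; exact: (continuousD (cp0 t) (cs t)).
- split=> [t _||]; first by case: (dr t).
  + exact/cvg_at_right_filter/cr.
  + exact/cvg_at_left_filter/cr.
- move=> t _; rewrite derive1E (@derive_val _ _ _ _ _ _ _ (dr t)) mul1r.
  by congr (_ + _); apply: eq_bigr => i _; rewrite mxE expr1 mulrA [t * _]mulrC.
Qed.

Lemma euler1_eq0 f x : (forall y, differentiable f y) ->
  (forall y : 'rV[R]_n, f y + \sum_i y 0 i * partial i f y = 0) -> f x = 0.
Proof.
move=> df f0.
have [|t _] := @MVT R _ _ 0 1 ltr01 (fun t _ => is_derive_ray x t df).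
  by apply: derivable_within_continuous => t _; case: (is_derive_ray x t df).
by rewrite f0 !mul0r mul1r subr0 scale1r.
Qed.

(** The mean value theorem from 0 to [x] expresses [f x - f 0] by the partials at some [t *: x];
    multiplied by [t > 0] this is the Euler sum at [t *: x], which vanishes. *)
Lemma euler_eq0 f x : (forall y, differentiable f y) ->
  (forall y : 'rV[R]_n, \sum_i y 0 i * partial i f y = 0) -> f x = f 0.
Proof.
move=> df f0; have [t /andP[t0 _]] := line_MVT 0 x df.
rewrite !add0r => fE; apply/eqP.
rewrite -subr_eq0 fE -(mulrI_eq0 _ (lregP (lt0r_neq0 t0))).
rewrite mulr_sumr -[X in _ == X](f0 (t *: x)).
by apply/eqP/eq_bigr => i _; rewrite mxE mulrA.
Qed.

End ray_average.

(** * Finite-rank retracts *)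

Section linear_maps.
Context {R : realType}.
Implicit Types V W U : lmodType R.

Lemma linear_eq V W (f g : {linear V -> W}) : f =1 g -> f = g.
Proof.
move=> /funext; case: f g => [f [[fa] [fs]]] [g [[ga] [gs]]] /= fg.
rewrite fg in fa fs *.
by rewrite (Prop_irrelevance fa ga) (Prop_irrelevance fs gs).
Qed.

(* A maximal subspace avoiding [w] is a complement of the line through [w]. *)
Lemma exists_functional V (w : V) : w != 0 ->
  exists f : {linear V -> R^o}, f w = 1.
Proof.
move=> w0; pose P (A : set V) := (forall c x y, A x -> A y -> A (c *: x + y)) /\ ~ A w.
have [F FP totF|H [[HD Hw] Hmax]] := @Zorn_bigcup _ P.
  split=> [c x y [X FX Xx] [Y FY Yy]|[X FX]]; last by case: (FP X FX).
  have [XY|YX] := totF _ _ FX FY.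
    by exists Y => //; apply: (FP Y FY).1 => //; exact: XY.
  by exists X => //; apply: (FP X FX).1 => //; exact: YX.
(* The empty set satisfies [P], so nonemptiness must come from maximality: if [H] missed 0 it would
   be empty, and the zero subspace would properly contain it. *)
have H0 : H 0.
  apply: contrapT => H0; apply: (Hmax [set 0]).
    split; last by move=> /(_ 0 erefl).
    move=> x Hx; exfalso; apply: H0.
    by rewrite -(addNr x) -scaleN1r; exact: HD.
  split=> [c x y -> ->|/= w0']; first by rewrite scaler0 addr0.
  by rewrite w0' eqxx in w0.
have HB c x : H x -> H (c *: x) by move=> Hx; rewrite -[_ *: _]addr0; exact: HD.
(* If [v] is outside [H], the span of [H] and [v] contains [w] by maximality, say [w = y + a *: v];
   then [a] is nonzero and [c = a^-1] works. *)
have dec v : exists c : R, H (v - c *: w).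
  have [Hv|Hv] := pselect (H v); first by exists 0; rewrite scale0r subr0.
  pose B : set V := [set x | exists a y, H y /\ x = y + a *: v].
  have : ~ P B.
    apply: Hmax; split=> [x Hx|/(_ v)].
      by exists 0, x; rewrite scale0r addr0.
    by move=> Bv; apply/Hv/Bv; exists 1, 0; rewrite scale1r add0r.
  move=> nPB; have [a [y [Hy wE]]] : B w.
    apply: contrapT => nBw; apply: nPB; split=> // c _ _ [a [x [Hx ->]]] [b [y [Hy ->]]].
    exists (c * a + b), (c *: x + y); split; first exact: HD.
    by rewrite scalerDr scalerDl scalerA addrACA.
  have a0 : a != 0 by apply/eqP => a0; apply: Hw; rewrite wE a0 scale0r addr0.
  exists a^-1; rewrite wE scalerDr scalerA mulVf// scale1r.
  by rewrite opprD addrCA subrr addr0 -scaleNr; exact: HB.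
have uniq v c c' : H (v - c *: w) -> H (v - c' *: w) -> c = c'.
  move=> Hc Hc'; apply/eqP; rewrite -subr_eq0; apply/negPn/negP => cc'; apply: Hw.
  rewrite -[w](scalerK cc'); apply: HB.
  rewrite (_ : _ *: w = -1 *: (v - c *: w) + (v - c' *: w)); first exact: HD.
  by rewrite scaleN1r opprB subrKA scalerBl.
have [f fP] := choice dec.
have lf : linear (f : V -> R^o).
  move=> c x y; apply: (uniq (c *: x + y)); first exact: fP.
  rewrite (_ : _ - _ = c *: (x - f x *: w) + (y - f y *: w)); first exact: HD.
  by rewrite scalerDl scalerBr scalerA addrACA opprD.
pose f' : {linear V -> R^o} := HB.pack (f : V -> R^o)
  (GRing.isLinear.Build R V R^o *:%R (f : V -> R^o) lf).
exists f'.
apply: (uniq w); first exact: fP.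
by rewrite scale1r subrr.
Qed.

(** Induction on the list: a new vector costs one more dimension only if the current [u \o phi] does
    not already fix it. *)
Lemma finite_rank_section V (s : seq V) :
  exists p (phi : {linear V -> 'rV[R]_p}) (u : {linear 'rV[R]_p -> V}),
    {in s, forall v, u (phi v) = v}.
Proof.
elim: s => [|v s [p [phi [u us]]]].
  by exists 0, \0, \0.
pose w := v - u (phi v).
have [w0|w0] := eqVneq w 0.
  exists p, phi, u => x; rewrite inE => /predU1P[->|/us//].
  by apply/eqP; rewrite eq_sym -subr_eq0; exact/eqP.
have [f fw] := exists_functional w0.
(* The added coordinate reads the defect [x - u (phi x)] through [f]: it is 1 on [v] and 0 on
   vectors already fixed. *)
pose phi' x : 'rV[R]_(p + 1) := row_mx (phi x) (const_mx (f (x - u (phi x)))).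
have lphi' : linear phi'.
  move=> c x y; rewrite /phi' scale_row_mx add_row_mx linearP; congr row_mx.
  apply/rowP => i; rewrite !mxE.
  rewrite (_ : _ - _ = c *: (x - u (phi x)) + (y - u (phi y))); first exact: linearP.
  by rewrite (linearP u) scalerBr opprD addrACA.
pose u' (y : 'rV[R]_(p + 1)) := u (lsubmx y) + rsubmx y 0 0 *: w.
have lu' : linear u'.
  move=> c x y; rewrite /u' (linearP (@lsubmx R 1 p 1)) (linearP (@rsubmx R 1 p 1)) linearP.
  rewrite !mxE scalerDl [c *: (_ + _)]scalerDr scalerA.
  by rewrite addrACA.
pose phi'' : {linear V -> 'rV[R]_(p + 1)} := HB.pack phi'
  (GRing.isLinear.Build R V 'rV[R]_(p + 1) *:%R phi' lphi').
pose u'' : {linear 'rV[R]_(p + 1) -> V} := HB.pack u'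
  (GRing.isLinear.Build R 'rV[R]_(p + 1) V *:%R u' lu').
exists (p + 1)%N, phi'', u'' => x; rewrite -[LHS]/(u' (phi' x)).
rewrite /u' /phi' row_mxKl row_mxKr mxE inE => /predU1P[->|xs].
  by rewrite fw scale1r /w addrC subrK.
by rewrite us// subrr linear0 scale0r addr0.
Qed.

End linear_maps.

(** * Induction on the free ring and finite supports *)

Section free_ring_generation.
Context {R : realType} (V : lmodType R).

Lemma Sinf_ind (P : Sinf V -> Prop) : (forall v, P (Sinf_eta v)) ->
  (forall m (f : smooth_fun R m) a, (forall i, P (a i)) -> P (cop f a)) ->
  forall x, P x.
Proof.
move=> Peta Pcop x; rewrite -[x](reprK (x : Sinf_sort V)).
elim: (repr _) => [v|m f a IHa]; first exact: Peta.
rewrite (_ : \pi_(Sinf_sort V) (COp f a) =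
    cop (c := Sinf V) f (fun i => \pi_(Sinf_sort V) (a i))); first exact: Pcop.
apply: Sinf_sort_ext => A h; rewrite !ceval_repr/=; congr cop.
by apply/funext => i; rewrite ceval_repr.
Qed.

Lemma Sinf_map_morphism (W : lmodType R) (f : {linear V -> W}) :
  cinf_morphism (Sinf_map f : Sinf V -> Sinf W).
Proof. exact: Sinf_ext_morphism. Qed.

Lemma Sinf_map_eta (W : lmodType R) (f : {linear V -> W}) v :
  Sinf_map f (Sinf_eta v) = Sinf_eta (f v).
Proof. exact: Sinf_extE. Qed.

(** A term mentions finitely many vectors of [V]; the list for an operation concatenates those of
    its arguments. *)
Lemma Sinf_finite_support (x : Sinf V) : exists s : seq V,
  forall f : {linear V -> V}, {in s, forall v, f v = v} -> Sinf_map f x = x.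
Proof.
elim/Sinf_ind: x => [v|m g a].
  by exists [:: v] => f fs; rewrite Sinf_map_eta fs// mem_head.
move=> /choice[s sP]; exists (flatten [seq s i | i : 'I_m]) => f fs.
rewrite Sinf_map_morphism; congr cop; apply/funext => i; apply: sP => v vs.
by apply: fs; apply/flattenP; exists (s i) => //; exact: map_f (mem_enum _ _).
Qed.

End free_ring_generation.

(** * The derivation *)

Section smooth_ring.
Context {R : realType}.

Lemma Cinf_addE n (f g : @Cinf_Rn R n) : f + g = sf_add f g.
Proof. by apply: sfun_ext => x /=; rewrite !mxE. Qed.

Lemma Cinf_mulE n (f g : @Cinf_Rn R n) : f * g = sf_mul f g.
Proof. by apply: sfun_ext => x /=; rewrite !mxE. Qed.

Lemma Cinf_cstE n c : ccst (@Cinf_Rn R n) c = sf_cst n c.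
Proof. exact: sfun_ext. Qed.

Lemma Cinf_sumE n m (f : 'I_m -> @Cinf_Rn R n) (x : 'rV[R]_n) :
  (\sum_i f i : smooth_fun R n) x = \sum_i (f i : smooth_fun R n) x.
Proof.
elim: m f => [|m IHm] f; first by rewrite !big_ord0 [0]Cinf_cstE.
by rewrite !big_ord_recl Cinf_addE /= IHm.
Qed.

(** Carries identities between smooth functions, such as the chain rule, into an arbitrary
    C^oo-ring. *)
Lemma cop_morphism (A : CinfRing R) m (a : 'I_m -> A) :
  cinf_morphism (fun f : @Cinf_Rn R m => cop f a).
Proof. by move=> n f x; exact: cop_comp. Qed.

Lemma cinf_morphism0 (A B : CinfRing R) (phi : A -> B) :
  cinf_morphism phi -> phi 0 = 0.
Proof. exact: cinf_morphism_cst. Qed.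

Lemma cinf_morphism1 (A B : CinfRing R) (phi : A -> B) :
  cinf_morphism phi -> phi 1 = 1.
Proof. exact: cinf_morphism_cst. Qed.

Lemma cinf_morphism_sum (A B : CinfRing R) (phi : A -> B) m (a : 'I_m -> A) :
  cinf_morphism phi -> phi (\sum_i a i) = \sum_i phi (a i).
Proof.
move=> mphi; elim: m a => [|m IHm] a; first by rewrite !big_ord0 cinf_morphism0.
by rewrite !big_ord_recl cinf_morphismD// IHm.
Qed.

Lemma sf_partial_comp m n (g : smooth_fun R n) (f : 'I_n -> smooth_fun R m) i :
  sf_partial i (sf_comp g f) =
  \sum_j (sf_comp (sf_partial j g) f : @Cinf_Rn R m) * sf_partial i (f j).
Proof.
apply: sfun_ext => x; rewrite Cinf_sumE [LHS]/= partial_comp.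
- by apply: eq_bigr => j _; rewrite Cinf_mulE.
- by move=> y; exact: (CkS_diff _ (sfun_smooth g 1)).
- by move=> j y; exact: (CkS_diff _ (sfun_smooth (f j) 1)).
Qed.

Lemma sf_partial_proj n (i j : 'I_n) :
  sf_partial i (sf_proj j) = sf_cst n ((j == i)%:R) :> smooth_fun R n.
Proof. by apply: sfun_ext => x /=; rewrite partial_coord. Qed.

Lemma sf_partial_add n (i : 'I_n) (f g : smooth_fun R n) :
  sf_partial i (sf_add f g) = sf_add (sf_partial i f) (sf_partial i g).
Proof.
apply: sfun_ext => x /=; rewrite /partial deriveD//; apply: diff_derivable.
  exact: (CkS_diff _ (sfun_smooth f 1)).
exact: (CkS_diff _ (sfun_smooth g 1)).
Qed.

Lemma sf_partial_mul n (i : 'I_n) (f g : smooth_fun R n) :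
  sf_partial i (sf_mul f g) =
  sf_add (sf_mul f (sf_partial i g)) (sf_mul g (sf_partial i f)).
Proof.
apply: sfun_ext => x /=; rewrite /partial deriveM//; apply: diff_derivable.
  exact: (CkS_diff _ (sfun_smooth f 1)).
exact: (CkS_diff _ (sfun_smooth g 1)).
Qed.

Lemma sf_partialC n (i j : 'I_n) (f : smooth_fun R n) :
  sf_partial i (sf_partial j f) = sf_partial j (sf_partial i f).
Proof.
by apply: sfun_ext => x /=; rewrite partialC//; exact: (sfun_smooth f 2).
Qed.

End smooth_ring.

Section cop_ring.
Context {R : realType} (A : CinfRing R) (m : nat).
Context (f g : smooth_fun R m) (a : 'I_m -> A).

Lemma cop_addE : cop (sf_add f g) a = cop f a + cop g a.
Proof. exact: cop_add. Qed.

Lemma cop_mulE : cop (sf_mul f g) a = cop f a * cop g a.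
Proof. exact: cop_mul. Qed.

End cop_ring.

(** * Induction on tensors and the module structure of A (x) V over A *)

Section tensor_induction.
Context {R : realType}.
Lemma tens_ind (V W : lmodType R) (P : V \ox W -> Prop) :
  P 0 -> (forall x y, P x -> P y -> P (x + y)) -> (forall v w, P (tens v w)) ->
  forall x, P x.
Proof.
by move=> P0 PD Pt x; rewrite (tensor_span x); elim/big_ind: _.
Qed.
End tensor_induction.

Section action.
Context {R : realType} (A : CinfRing R) (V : lmodType R).
Implicit Types (a b : A) (x y : A \ox V).

Lemma cmul_linear a : linear (cmul a).
Proof. by move=> c x y; exact: (cinf_mul_bilinear A).2. Qed.
HB.instance Definition _ a := GRing.isLinear.Build R (csort A) (csort A) *:%R
  (cmul a) (cmul_linear a).

Definition act a : {linear A \ox V -> A \ox V} :=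
  tensm (@cmul R A a) idfun.

Lemma actE a b v : act a (tens b v) = tens (a * b) v.
Proof. exact: tensmE. Qed.

Lemma actDl a b x : act (a + b) x = act a x + act b x.
Proof.
elim/(@tens_ind R A V): x => [|x y IHx IHy|c v]; first by rewrite !linear0 addr0.
  by rewrite !linearD IHx IHy addrACA.
by rewrite !actE mulrDl linearDl.
Qed.

Lemma act0l x : act 0 x = 0.
Proof. by apply: (addrI (act 0 x)); rewrite -actDl !addr0. Qed.

Lemma actM a b x : act (a * b) x = act a (act b x).
Proof.
elim/(@tens_ind R A V): x => [|x y IHx IHy|c v]; first by rewrite !linear0.
  by rewrite !linearD IHx IHy.
by rewrite !actE mulrA.
Qed.

Lemma act1l x : act 1 x = x.
Proof.
elim/(@tens_ind R A V): x => [|x y IHx IHy|c v]; first by rewrite !linear0.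
  by rewrite !linearD IHx IHy.
by rewrite !actE mul1r.
Qed.

Lemma actcst c x : act (ccst A c) x = c *: x.
Proof.
elim/(@tens_ind R A V): x => [|x y IHx IHy|b v]; first by rewrite !linear0.
  by rewrite !linearD IHx IHy.
by rewrite actE -linearZl_LR.
Qed.

Lemma act_suml n (a : 'I_n -> A) x : act (\sum_i a i) x = \sum_i act (a i) x.
Proof.
elim: n a => [|n IHn] a; first by rewrite !big_ord0 act0l.
by rewrite !big_ord_recl actDl IHn.
Qed.

End action.
Arguments act {R A V} a : simpl never.

(* The square-zero extension of a C^oo-ring [A] by the module [A \ox V]: a
   morphism into it is a morphism into [A] with a C^oo-derivation along it. *)
Section square_zero.
Context {R : realType} (A : CinfRing R) (V : lmodType R).

(** First-order Taylor formula: [f (a + h) = f a + \sum_i (partial i f) a * h_i], with products of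
    two [h_i] set to zero. *)
Definition sqz_op m (f : smooth_fun R m) (p : 'I_m -> A * (A \ox V)) :
    A * (A \ox V) :=
  let a := fun i => (p i).1 in
  (cop f a, \sum_i act (cop (sf_partial i f) a) (p i).2).

Lemma sqz_proj m (i : 'I_m) p : sqz_op (sf_proj i) p = p i.
Proof.
rewrite /sqz_op cop_proj [RHS]surjective_pairing; congr pair.
rewrite (bigD1 i)//= big1 => [|j ji]; rewrite sf_partial_proj cop_cst.
  by rewrite eqxx act1l addr0.
by rewrite eq_sym (negPf ji) act0l.
Qed.

(** In the second component this is the chain rule [sf_partial_comp], evaluated at [a] by
    [cop_morphism]. *)
Lemma sqz_comp m n (g : smooth_fun R n) (f : 'I_n -> smooth_fun R m) p :
  sqz_op (sf_comp g f) p = sqz_op g (fun j => sqz_op (f j) p).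
Proof.
rewrite /sqz_op /= cop_comp; congr pair.
under [RHS]eq_bigr do rewrite linear_sum.
rewrite exchange_big /=; apply: eq_bigr => i _.
rewrite sf_partial_comp (cinf_morphism_sum _ (cop_morphism _)) act_suml.
by apply: eq_bigr => j _; rewrite (cinf_morphismM (cop_morphism _)) actM cop_comp.
Qed.

Definition sqz : CinfRing R := MkCinfRing sqz_proj sqz_comp.

Lemma sqz_fst : cinf_morphism (fst : sqz -> A).
Proof. by []. Qed.

Lemma sqz_addE (p q : sqz) : p + q = (p.1 + q.1, p.2 + q.2).
Proof.
rewrite [LHS]surjective_pairing; congr pair; first exact: cinf_morphismD sqz_fst _ _.
rewrite [LHS]/= big_ord_recl big_ord1 !sf_partial_add !sf_partial_proj.
by rewrite !cop_addE !cop_cst addr0 add0r !act1l.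
Qed.

Lemma sqz_scaleE c (p : sqz) : c *: p = (c *: p.1, c *: p.2).
Proof.
rewrite [LHS]surjective_pairing; congr pair.
  rewrite [LHS](cinf_morphismM sqz_fst) (cinf_morphism_cst _ sqz_fst). by []. 
pose a (i : 'I_2) := tnth [tuple ccst sqz c; p] i.
rewrite -[LHS]/(\sum_i act (cop (sf_partial i (sf_mul (sf_proj 0) (sf_proj 1)))
  (fun j => (a j).1)) (a i).2) big_ord_recl big_ord1.
(* A constant is a nullary operation, so its derivative component is an empty sum. *)
have -> : (a ord0).2 = 0 by apply: big_ord0.
have -> : (a (lift ord0 ord0)).2 = p.2 by [].
rewrite linear0 add0r !sf_partial_mul !sf_partial_proj.
rewrite cop_addE !cop_mulE !cop_cst !cop_proj mulr0 addr0 mulr1.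
have -> : (a 0).1 = ccst A c by exact: (cinf_morphism_cst _ sqz_fst).
exact: actcst.
Qed.

End square_zero.

Section derivation.
Context {R : realType} (V : lmodType R).

(** The derivative of a generator is the one prescribed by [d.3]; freeness then extends it to all of
    [Sinf V]. *)
Definition dgen (v : V) : sqz (Sinf V) V := (Sinf_eta v, tens (1 : Sinf V) v).

Lemma dgen_linear : linear dgen.
Proof.
by move=> c x y; rewrite /dgen !linearP sqz_addE sqz_scaleE.
Qed.

HB.instance Definition _ := GRing.isLinear.Build R V (csort (sqz (Sinf V) V)) *:%R
  dgen dgen_linear.

Definition der (x : Sinf_ob V) : Sinf_ob V \ox V := (Sinf_ext dgen x).2.

Lemma der_linear : linear der.
Proof.
move=> c x y; rewrite /der.
by rewrite (cinf_morphism_linear (Sinf_ext_morphism dgen)) sqz_addE sqz_scaleE.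
Qed.

HB.instance Definition _ := GRing.isLinear.Build R (Sinf_ob V) (Sinf_ob V \ox V) *:%R
  der der_linear.

(** The classifying morphism is a section of [fst], so [der] is a derivation along the identity. *)
Lemma Sinf_ext_dgen_fst (x : Sinf V) : (Sinf_ext dgen x).1 = x.
Proof.
elim/(@Sinf_ind R V): x => [v|m f a IHa]; first by rewrite Sinf_extE.
by rewrite Sinf_ext_morphism /=; congr cop; apply/funext => i; exact: IHa.
Qed.

Lemma der_eta v : der (Sinf_eta v) = tens (1 : Sinf V) v.
Proof. by rewrite /der Sinf_extE. Qed.

Lemma der_cop m (f : smooth_fun R m) (a : 'I_m -> Sinf V) :
  der (cop f a) = \sum_i act (cop (sf_partial i f) a) (der (a i)).
Proof.
rewrite /der Sinf_ext_morphism; apply: eq_bigr => i _; congr (act (cop _ _) _).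
by apply/funext => j; exact: Sinf_ext_dgen_fst.
Qed.

Lemma derM (x y : Sinf V) : der (x * y : Sinf V) = act x (der y) + act y (der x).
Proof.
pose a (i : 'I_2) : Sinf V := tnth [tuple x; y] i.
rewrite -[x * y]/(cop (sf_mul (sf_proj 0) (sf_proj 1)) a) der_cop big_ord_recl big_ord1.
rewrite !sf_partial_mul !sf_partial_proj !cop_addE !cop_mulE !cop_cst !cop_proj.
by rewrite !mulr0 !mulr1 add0r addr0 addrC.
Qed.

Lemma der1 : der (1 : Sinf V) = 0.
Proof. by rewrite der_cop big_ord0. Qed.

End derivation.

(* [simpl] would also unfold the tensor maps. *)
Ltac unfold_modality :=
  cbn [catcomp comp Sob Smap Smu Seta Smul Sone Sinf_modality].

(** * The codifferential structure *)

Section functoriality.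
Context {R : realType}.
Implicit Types V W X : lmodType R.

(** Uniqueness in the universal property; it reduces the monad laws to generators. *)
Lemma cinf_morphism_eq V (A : CinfRing R) (phi psi : Sinf V -> A) :
  cinf_morphism phi -> cinf_morphism psi ->
  (forall v, phi (Sinf_eta v) = psi (Sinf_eta v)) -> phi =1 psi.
Proof.
move=> mphi mpsi e x; elim/(@Sinf_ind R V): x => [//|m f a IHa].
by rewrite mphi mpsi; congr cop; apply/funext.
Qed.

Lemma cinf_morphism_comp (A B C : CinfRing R) (phi : A -> B) (psi : B -> C) :
  cinf_morphism phi -> cinf_morphism psi -> cinf_morphism (psi \o phi).
Proof. by move=> mphi mpsi m f x; rewrite /= mphi mpsi. Qed.

Lemma Sinf_mu_morphism V : cinf_morphism (Sinf_mu V : Sinf (Sinf_ob V) -> Sinf V).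
Proof. exact: Sinf_ext_morphism. Qed.

Lemma Sinf_mu_eta V (x : Sinf_ob V) : Sinf_mu V (Sinf_eta x) = x.
Proof. exact: Sinf_extE. Qed.

Lemma Sinf_map_id V (f : {linear V -> V}) : f =1 idfun -> Sinf_map f =1 idfun.
Proof.
move=> f1; apply: cinf_morphism_eq => [|//|v]; first exact: Sinf_map_morphism.
by rewrite Sinf_map_eta f1.
Qed.

Lemma Sinf_map_comp V W X (f : {linear V -> W}) (g : {linear W -> X})
    (h : {linear V -> X}) :
  h =1 g \o f -> forall x, Sinf_map h x = Sinf_map g (Sinf_map f x).
Proof.
move=> hE; apply: (cinf_morphism_eq (psi := Sinf_map g \o Sinf_map f)).
- exact: Sinf_map_morphism.
- exact: cinf_morphism_comp (Sinf_map_morphism f) (Sinf_map_morphism g).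
- by move=> v; rewrite /= !Sinf_map_eta hE.
Qed.

Lemma Sinf_map_mu V W (f : {linear V -> W}) x :
  Sinf_mu W (Sinf_map (Sinf_map f) x) = Sinf_map f (Sinf_mu V x).
Proof.
apply: (cinf_morphism_eq (phi := Sinf_mu W \o Sinf_map (Sinf_map f))
   (psi := Sinf_map f \o Sinf_mu V)).
- exact: cinf_morphism_comp (Sinf_map_morphism _) (@Sinf_mu_morphism W).
- exact: cinf_morphism_comp (@Sinf_mu_morphism V) (Sinf_map_morphism _).
- by move=> v; rewrite /= Sinf_map_eta !Sinf_mu_eta.
Qed.

Lemma Sinf_is_monad : is_monad (Sinf_modality R).
Proof.
split=> [V|V W X f g|V W f v|V W f x|V x|V|V] /=.
- exact: Sinf_map_id.
- exact: Sinf_map_comp.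
- by rewrite Sinf_map_eta.
- exact: Sinf_map_mu.
- exact: Sinf_mu_eta.
- apply: (cinf_morphism_eq (phi := Sinf_mu V \o Sinf_map (@Sinf_eta R V))) => //.
    exact: cinf_morphism_comp (Sinf_map_morphism _) (@Sinf_mu_morphism V).
  by move=> v; rewrite /= Sinf_map_eta Sinf_mu_eta.
- apply: (cinf_morphism_eq (phi := Sinf_mu V \o Sinf_map (Sinf_mu V))
    (psi := Sinf_mu V \o Sinf_mu (Sinf_ob V))).
  + exact: cinf_morphism_comp (Sinf_map_morphism _) (@Sinf_mu_morphism V).
  + exact: cinf_morphism_comp (@Sinf_mu_morphism _) (@Sinf_mu_morphism V).
  + by move=> v; rewrite /= Sinf_map_eta !Sinf_mu_eta.
Qed.

Lemma Sinf_mulE V (x y : Sinf V) : Sinf_mul V (tens x y) = x * y.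
Proof. exact: tliftE. Qed.

Lemma Sinf_oneE V : Sinf_one V 1 = (1 : Sinf V).
Proof. exact: scale1r. Qed.

Lemma tlunitVE V v : tlunitV V v = tens (1 : R^o) v.
Proof. by []. Qed.

Lemma trunitVE V v : trunitV V v = tens v (1 : R^o).
Proof. exact: tsymE. Qed.

Lemma Sinf_is_algebra_modality : is_algebra_modality (Sinf_modality R).
Proof.
split; first exact: Sinf_is_monad.
- move=> V W f x; unfold_modality; elim/(@tens_ind R): x => [|x y IHx IHy|a b].
  + by rewrite !linear0.
  + by rewrite !linearD IHx IHy.
  + by rewrite tensmE !Sinf_mulE (cinf_morphismM (Sinf_map_morphism f)).
- move=> V W f c; unfold_modality; rewrite linearZ.
  by rewrite (cinf_morphism1 (Sinf_map_morphism f)).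
- move=> V x; unfold_modality; elim/(@tens_ind R): x => [|x y IHx IHy|x c].
  + by rewrite !linear0.
  + by rewrite !linearD IHx IHy.
  + elim/(@tens_ind R): x => [|x y IHx IHy|a b].
    * by rewrite linear0l !linear0.
    * by rewrite linearDl !linearD IHx IHy.
    * by rewrite tassocE !tensmE !Sinf_mulE mulrA.
- move=> V x; unfold_modality; by rewrite tlunitVE tensmE Sinf_mulE Sinf_oneE mul1r.
- move=> V x; unfold_modality; by rewrite trunitVE tensmE Sinf_mulE Sinf_oneE mulr1.
- move=> V x; unfold_modality; elim/(@tens_ind R): x => [|x y IHx IHy|a b].
  + by rewrite !linear0.
  + by rewrite !linearD IHx IHy.
  + by rewrite tsymE !Sinf_mulE mulrC.
- move=> V x; unfold_modality; elim/(@tens_ind R): x => [|x y IHx IHy|a b].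
  + by rewrite !linear0.
  + by rewrite !linearD IHx IHy.
  + by rewrite tensmE !Sinf_mulE (cinf_morphismM (@Sinf_mu_morphism V)).
- move=> V c; unfold_modality; rewrite linearZ.
  by rewrite (cinf_morphism1 (@Sinf_mu_morphism V)).
Qed.
End functoriality.

(** * Uniqueness of the deriving transformation and its axioms *)

Section deriving.
Context {R : realType}.
Implicit Types V W : lmodType R.

Definition Sinf_d V : {linear Sinf_ob V -> Sinf_ob V \ox V} := @der R V.

Lemma tensm_act V W (f : {linear V -> W}) (a : Sinf V) x :
  tensm (Sinf_map f) f (act a x) =
  act (Sinf_map f a : Sinf W) (tensm (Sinf_map f) f x).
Proof.
elim/(@tens_ind R): x => [|x y IHx IHy|b v].
- by rewrite !linear0.
- by rewrite !linearD IHx IHy.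
- by rewrite actE [X in act _ X]tensmE actE tensmE (cinf_morphismM (Sinf_map_morphism f)).
Qed.

Lemma der_map V W (f : {linear V -> W}) x :
  der (Sinf_map f x) = tensm (Sinf_map f) f (der x).
Proof.
elim/(@Sinf_ind R V): x => [v|m g a IHa].
  rewrite Sinf_map_eta !der_eta tensmE; congr tens.
  by rewrite (cinf_morphism1 (Sinf_map_morphism f)).
rewrite Sinf_map_morphism !der_cop linear_sum; apply: eq_bigr => i _.
by rewrite tensm_act [in RHS]Sinf_map_morphism /= IHa.
Qed.

Lemma der_of_smooth n (f : smooth_fun R n) :
  der (Sinf_of_smooth f) = \sum_(i < n) tens (Sinf_of_smooth (sf_partial i f)) 'e_i.
Proof.
rewrite der_cop; apply: eq_bigr => i _.
by rewrite der_eta actE mulr1.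
Qed.

Lemma Sinf_d_is_deriving : is_Sinf_deriving Sinf_d.
Proof. by split=> [V W f x|n f]; [exact: der_map|exact: der_of_smooth]. Qed.

Lemma Sinf_map_of_smooth V n (u : {linear 'rV[R]_n -> V}) (f : smooth_fun R n) :
  Sinf_map u (Sinf_of_smooth f) = cop (c := Sinf V) f (fun i => Sinf_eta (u 'e_i)).
Proof.
rewrite Sinf_map_morphism; congr cop; apply/funext => i; exact: Sinf_map_eta.
Qed.

(** Choose [u \o phi] to fix a support of [x]. The first conjunct carries hypotheses on [x] to R^n;
    the second brings conclusions back to [V]. *)
Lemma Sinf_finite_rank V (x : Sinf_ob V) : exists n (phi : {linear V -> 'rV[R]_n})
  (u : {linear 'rV[R]_n -> V}) (f : smooth_fun R n),
  Sinf_map phi x = Sinf_of_smooth f /\ x = Sinf_map u (Sinf_of_smooth f).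
Proof.
have [s sP] := Sinf_finite_support x.
have [n [phi [u us]]] := finite_rank_section s.
have [g _ gK] := @Sinf_of_smooth_bij R n.
exists n, phi, u, (g (Sinf_map phi x)); split; first by rewrite gK.
rewrite gK -(Sinf_map_comp (h := u \o phi))//.
by rewrite sP.
Qed.

Lemma Sinf_deriving_uniq (d : forall V, {linear Sinf_ob V -> Sinf_ob V \ox V}) :
  is_Sinf_deriving d -> d = Sinf_d.
Proof.
move=> [dnat dE]; apply: functional_extensionality_dep => V; apply: linear_eq => x.
have [n [_ [u [f [_ ->]]]]] := Sinf_finite_rank x.
rewrite -[LHS]/((Sinf_map u \; d V) _) dnat /catcomp /= dE.
by rewrite [RHS]der_map der_of_smooth.
Qed.

Lemma der_scale_one V (c : R) : der (c *: (1 : Sinf V)) = 0.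
Proof. by transitivity (c *: der (1 : Sinf V)); [exact: linearZ|rewrite der1 scaler0]. Qed.

(** With [mul_actr], turns the associator and symmetry composites of [d.2], [d.4] and [s.2] into the
    module action. *)
Lemma mul_actl V (x : Sinf V) y :
  tensm (Sinf_mul V) idfun (tassocV (Sinf_ob V) (Sinf_ob V) V (tens x y)) = act x y.
Proof.
elim/(@tens_ind R): y => [|y z IHy IHz|b v].
- by rewrite linear0r !linear0.
- by rewrite linearDr !linearD IHy IHz.
- by rewrite tassocVE tensmE Sinf_mulE actE.
Qed.

Lemma tswap23E (A B C : lmodType R) (a : A) (b : B) (c : C) :
  tswap23 A B C (tens (tens a b) c) = tens (tens a c) b.
Proof.
by rewrite /tswap23 /= [X in tassocV _ _ _ (_ X)]tassocE tensmE tsymE tassocVE.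
Qed.

Lemma mul_actr V (x : Sinf V) y :
  tensm (Sinf_mul V) idfun (tswap23 (Sinf_ob V) V (Sinf_ob V) (tens y x)) = act x y.
Proof.
elim/(@tens_ind R): y => [|y z IHy IHz|b v].
- by rewrite linear0l !linear0.
- by rewrite linearDl !linearD IHy IHz.
- by rewrite tswap23E tensmE Sinf_mulE actE mulrC.
Qed.

(** By induction on [x]: on a generator the coefficient 1 acts trivially; on an operation both sides
    expand by [der_cop], and the summands agree since [Sinf_mu] preserves each partial
    derivative. *)
Lemma der_mu V x : der (Sinf_mu V x) = tensm (Sinf_mul V) idfun
  (tassocV (Sinf_ob V) (Sinf_ob V) V (tensm (Sinf_mu V) (Sinf_d V) (der x))).
Proof.
elim/(@Sinf_ind R): x => [x|m f a IHa].
  rewrite Sinf_mu_eta der_eta tensmE (cinf_morphism1 (@Sinf_mu_morphism _ V)).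
  by rewrite mul_actl act1l.
pose T : {linear _ -> Sinf_ob V \ox V} := tensm (Sinf_mul V) idfun \o
  (tassocV (Sinf_ob V) (Sinf_ob V) V \o tensm (Sinf_mu V) (Sinf_d V)).
rewrite Sinf_mu_morphism !der_cop -[RHS]/(T _) linear_sum; apply: eq_bigr => i _.
rewrite [der _]IHa -[RHS]/(tensm (Sinf_mul V) idfun
  (tassocV (Sinf_ob V) (Sinf_ob V) V (tensm (Sinf_mu V) (Sinf_d V) _))).
rewrite -(Sinf_mu_morphism (sf_partial i f) a).
elim/(@tens_ind R): (der (a i)) => [|y z IHy IHz|b v].
- by rewrite !linear0.
- by rewrite !linearD IHy IHz.
- by rewrite actE !tensmE !mul_actl (cinf_morphismM (@Sinf_mu_morphism _ V)) actM.
Qed.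

Lemma der_der_swap V (x : Sinf_ob V) :
  tensm (Sinf_d V) idfun (der x) =
  tswap23 (Sinf_ob V) V V (tensm (Sinf_d V) idfun (der x)).
Proof.
have [n [_ [u [f [_ ->]]]]] := Sinf_finite_rank x.
(* On generators [der] has coefficient 1, so iterating it on [cop f a] yields only second partials
   of [f]. *)
pose a i : Sinf V := Sinf_eta (u 'e_i).
have dE (g : smooth_fun R n) :
    der (cop g a) = \sum_i tens (cop (sf_partial i g) a) (u 'e_i).
  by rewrite der_cop; apply: eq_bigr => i _; rewrite der_eta actE mulr1.
rewrite Sinf_map_of_smooth -/a.
have -> : tensm (Sinf_d V) idfun (der (cop f a)) = \sum_i \sum_j
    tens (tens (cop (sf_partial j (sf_partial i f)) a) (u 'e_j)) (u 'e_i).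
  rewrite dE linear_sum; apply: eq_bigr => i _.
  by rewrite tensmE [Sinf_d V _]dE; exact: (linear_sum (applyr (@tens R _ _) (u 'e_i))).
rewrite linear_sum exchange_big; apply: eq_bigr => i _.
rewrite linear_sum; apply: eq_bigr => j _.
by rewrite tswap23E sf_partialC.
Qed.

Lemma Sinf_d_deriving : is_deriving (Sinf_modality R) Sinf_d.
Proof.
split.
- by move=> V W f x; exact: der_map.
- by move=> V c; exact: der_scale_one.
- move=> V x; unfold_modality; rewrite [RHS]/GRing.add_fun; unfold_modality.
  elim/(@tens_ind R): x => [|x y IHx IHy|a b].
  + by rewrite !linear0 addr0.
  + by rewrite !linearD IHx IHy addrACA.
  + by rewrite !tensmE Sinf_mulE mul_actl mul_actr -derM.
- move=> V v; unfold_modality; rewrite tlunitVE tensmE Sinf_oneE; exact: der_eta.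
- by move=> V x; exact: der_mu.
- by move=> V x; exact: der_der_swap.
Qed.

End deriving.

(** * The Euler operator *)

Section euler.
Context {R : realType}.
Implicit Types V W : lmodType R.
Local Notation M := (Sinf_modality R).
Local Notation S0 V := (Sinf_map (\0 : {linear V -> V})).

Lemma coderivingE V (x : Sinf V) v : coderiving M V (tens x v) = x * Sinf_eta v.
Proof. by rewrite /coderiving /= [X in tlift _ X]tensmE [LHS]tliftE. Qed.

Lemma coderiving_act V (a : Sinf V) y :
  coderiving M V (act a y) = a * (coderiving M V y : Sinf V).
Proof.
elim/(@tens_ind R): y => [|x y IHx IHy|b v].
- by rewrite !linear0 mulr0.
- by rewrite !linearD IHx IHy mulrDr.
- by rewrite actE !coderivingE mulrA.
Qed.

Lemma coderiving_map V W (f : {linear V -> W}) y :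
  coderiving M W (tensm (Sinf_map f) f y) = Sinf_map f (coderiving M V y).
Proof.
elim/(@tens_ind R): y => [|x y IHx IHy|b v].
- by rewrite !linear0.
- by rewrite !linearD IHx IHy.
- by rewrite tensmE !coderivingE (cinf_morphismM (Sinf_map_morphism f)) Sinf_map_eta.
Qed.

(** This is [Ltrans] for [Sinf_d]. *)
Definition euler V : {linear Sinf_ob V -> Sinf_ob V} := coderiving M V \o @der R V.

Lemma eulerE V x : euler V x = coderiving M V (der x).
Proof. by []. Qed.

Lemma euler_eta V v : euler V (Sinf_eta v) = Sinf_eta v.
Proof. by rewrite !eulerE der_eta coderivingE mul1r. Qed.

Lemma eulerM V (x y : Sinf V) :
  euler V (x * y : Sinf V) = x * (euler V y : Sinf V) + y * (euler V x : Sinf V).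
Proof. by rewrite !eulerE derM linearD !coderiving_act. Qed.

Lemma euler_map V W (f : {linear V -> W}) x :
  euler W (Sinf_map f x) = Sinf_map f (euler V x).
Proof. by rewrite !eulerE der_map coderiving_map. Qed.

Lemma S0_map V W (f : {linear V -> W}) x : S0 W (Sinf_map f x) = Sinf_map f (S0 V x).
Proof.
rewrite -(Sinf_map_comp (h := \0 : {linear V -> W}))//.
by rewrite -(Sinf_map_comp (h := \0 : {linear V -> W}))// => v; rewrite /= linear0.
Qed.

Lemma S0_S0 V x : S0 V (S0 V x) = S0 V x.
Proof. by rewrite -(Sinf_map_comp (h := \0 : {linear V -> V})). Qed.

(** By naturality the zero map acts on the factor [V], which sends every tensor to 0. *)
Lemma S0_coderiving V y : S0 V (coderiving M V y) = 0.
Proof.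
rewrite -coderiving_map; elim/(@tens_ind R): y => [|x y IHx IHy|b v].
- by rewrite !linear0.
- by rewrite !linearD IHx IHy addr0.
- by rewrite tensmE coderivingE linear0 mulr0.
Qed.

Lemma der_S0 V x : der (S0 V x) = 0.
Proof.
rewrite der_map; elim/(@tens_ind R): (der x) => [|y z IHx IHy|b v].
- by rewrite !linear0.
- by rewrite !linearD IHx IHy addr0.
- by rewrite tensmE linear0r.
Qed.

Definition euler1 V : {linear Sinf_ob V -> Sinf_ob V} := idfun \+ euler V.

Lemma euler1E V x : euler1 V x = x + euler V x.
Proof. by []. Qed.

Lemma euler_coderiving V y :
  euler V (coderiving M V y) = coderiving M V (tensm (euler1 V) idfun y).
Proof.
elim/(@tens_ind R): y => [|x y IHx IHy|b v].
- by rewrite !linear0.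
- by rewrite !linearD IHx IHy.
- rewrite tensmE !coderivingE eulerM euler_eta euler1E mulrDl.
  by rewrite [Sinf_eta v * _]mulrC.
Qed.

Definition sf_euler n (f : smooth_fun R n) : smooth_fun R n :=
  \sum_i (sf_proj i : @Cinf_Rn R n) * (sf_partial i f : @Cinf_Rn R n).

Lemma sf_eulerE n (f : smooth_fun R n) (x : 'rV[R]_n) :
  sf_euler f x = \sum_i x 0 i * partial i f x.
Proof. by rewrite Cinf_sumE; apply: eq_bigr => i _; rewrite Cinf_mulE. Qed.

Lemma euler_of_smooth n (f : smooth_fun R n) :
  euler 'rV[R]_n (Sinf_of_smooth f) = Sinf_of_smooth (sf_euler f).
Proof.
rewrite !eulerE der_of_smooth linear_sum.
rewrite (cinf_morphism_sum _ (@Sinf_of_smooth_morphism R n)); apply: eq_bigr => i _.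
rewrite coderivingE (cinf_morphismM (@Sinf_of_smooth_morphism R n)) mulrC; congr (_ * _).
by rewrite /Sinf_of_smooth cop_proj.
Qed.

Lemma euler1_of_smooth n (f : smooth_fun R n) :
  euler1 'rV[R]_n (Sinf_of_smooth f) = Sinf_of_smooth (sf_add f (sf_euler f)).
Proof. by rewrite euler1E euler_of_smooth -cop_addE. Qed.

Lemma Sinf_of_smooth_inj n : injective (@Sinf_of_smooth R n).
Proof. exact: (bij_inj (@Sinf_of_smooth_bij R n)). Qed.

Lemma Sinf_of_smooth0 n : Sinf_of_smooth (sf_cst n 0) = 0 :> Sinf_ob 'rV[R]_n.
Proof. exact: cop_cst. Qed.

Lemma S0_of_smooth n (f : smooth_fun R n) :
  S0 'rV[R]_n (Sinf_of_smooth f) = Sinf_of_smooth (sf_cst n (f 0)).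
Proof.
rewrite Sinf_map_of_smooth /Sinf_of_smooth.
rewrite (_ : sf_cst n (f 0) = sf_comp f (fun=> sf_cst n 0)).
  rewrite [RHS]cop_comp; congr cop; apply/funext => i.
  by rewrite cop_cst linear0.
by apply: sfun_ext => x /=; congr (f _); apply/rowP => i; rewrite !mxE.
Qed.

Lemma sfun_differentiable n (f : smooth_fun R n) y : differentiable f y.
Proof. exact: (CkS_diff _ (sfun_smooth f 1)). Qed.

(** An element of the kernel is pushed along [phi] to a smooth function on R^n, which vanishes by
    [euler1_eq0]; its image under [u] is the original element. *)
Lemma euler1_inj V : injective (euler1 V).
Proof.
move=> x y /eqP; rewrite -subr_eq0 -linearB => /eqP e0.
apply/eqP; rewrite -subr_eq0; apply/eqP; move: (x - y) e0 => {}x e0.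
have [n [phi [u [f [phix ->]]]]] := Sinf_finite_rank x.
rewrite (_ : f = sf_cst n 0) ?Sinf_of_smooth0 ?linear0//.
apply: sfun_ext => z; apply: euler1_eq0 => [y'|y']; first exact: sfun_differentiable.
have : Sinf_of_smooth (sf_add f (sf_euler f)) = Sinf_of_smooth (sf_cst n 0).
  rewrite -euler1_of_smooth Sinf_of_smooth0 -phix.
  transitivity (Sinf_map phi (euler1 V x)); first by rewrite !euler1E euler_map linearD.
  by rewrite e0 linear0.
move=> /Sinf_of_smooth_inj/(congr1 (fun g : smooth_fun R n => g y')) /=.
by rewrite sf_eulerE.
Qed.

Definition sf_ravg n (f : smooth_fun R n) : smooth_fun R n :=
  SmoothFun (fun k => Ck_ravg 0 (sfun_smooth f k)).

Lemma euler1_surj V x : exists y, euler1 V y = x.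
Proof.
have [n [_ [u [f [_ ->]]]]] := Sinf_finite_rank x.
(* The ray average is taken on R^n and pushed forward along [u], with which [euler1] commutes. *)
exists (Sinf_map u (Sinf_of_smooth (sf_ravg f))).
rewrite euler1E euler_map -linearD -euler1E; congr (Sinf_map u _).
rewrite euler1_of_smooth; congr Sinf_of_smooth.
apply: sfun_ext => z; rewrite /= sf_eulerE; apply: euler_ravg => [y|i].
  exact: sfun_differentiable.
exact: (sfun_smooth (sf_partial i f) 0).
Qed.

Lemma euler_eq0_S0 V x : euler V x = 0 -> S0 V x = x.
Proof.
move=> e0; have [n [phi [u [f [phix xE]]]]] := Sinf_finite_rank x.
rewrite {2}xE xE S0_map S0_of_smooth; congr (Sinf_map u (Sinf_of_smooth _)).
apply: sfun_ext => z; apply/esym/euler_eq0 => [y|y]; first exact: sfun_differentiable.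
have : Sinf_of_smooth (sf_euler f) = Sinf_of_smooth (sf_cst n 0).
  by rewrite -euler_of_smooth Sinf_of_smooth0 -phix euler_map e0 linear0.
move=> /Sinf_of_smooth_inj/(congr1 (fun g : smooth_fun R n => g y)) /=.
by rewrite sf_eulerE.
Qed.

End euler.

(** * Antiderivatives *)

Section antiderivatives.
Context {R : realType}.
Implicit Types V W : lmodType R.
Local Notation M := (Sinf_modality R).
Local Notation S0 V := (Sinf_map (\0 : {linear V -> V})).

(** The difference is killed by [L], hence equals its own image under S(0), which is 0. *)
Lemma euler_S0_inj V (x y : Sinf_ob V) :
  euler V x = euler V y -> S0 V x = S0 V y -> x = y.
Proof.
move=> exy sxy; apply/eqP; rewrite -subr_eq0; apply/eqP.
by rewrite -[LHS]euler_eq0_S0 linearB ?sxy ?exy subrr.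
Qed.

(** Elements of S V are not functions for general [V], so the average is taken as the preimage under
    [1 + L]; its uniqueness gives linearity and naturality. *)
Definition avg V (x : Sinf_ob V) : Sinf_ob V := projT1 (cid (euler1_surj x)).

Lemma avgK V : cancel (@avg V) (euler1 V).
Proof. by move=> x; rewrite /avg; case: cid. Qed.

Lemma euler1K V : cancel (euler1 V) (@avg V).
Proof. by move=> x; apply: euler1_inj; rewrite avgK. Qed.

Lemma avg_linear V : linear (@avg V).
Proof. by move=> c x y; apply: euler1_inj; rewrite linearP !avgK. Qed.

HB.instance Definition _ V := GRing.isLinear.Build R (Sinf_ob V) (Sinf_ob V) *:%R
  (@avg V) (@avg_linear V).

Lemma avg_map V W (f : {linear V -> W}) x : avg (Sinf_map f x) = Sinf_map f (avg x).
Proof. by apply: euler1_inj; rewrite avgK euler1E euler_map -linearD -euler1E avgK. Qed.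

Lemma euler_one V : euler V (1 : Sinf V) = 0.
Proof. by rewrite eulerE der1 linear0. Qed.

Lemma euler_S0 V x : euler V (S0 V x) = 0.
Proof. by rewrite eulerE der_S0 linear0. Qed.

Lemma avg1 V : avg (1 : Sinf V) = (1 : Sinf V).
Proof. by apply: euler1_inj; rewrite avgK euler1E euler_one addr0. Qed.

(** On R^n this is the line integral of a 1-form along the ray from 0 to [x]. *)
Definition integ V : {linear Sinf_ob V \ox V -> Sinf_ob V} :=
  coderiving M V \o tensm (@avg V) idfun.

Lemma integE V x v : integ V (tens x v) = (avg x : Sinf V) * Sinf_eta v.
Proof. by rewrite [LHS](congr1 (coderiving M V) (tensmE _ _ _ _)) coderivingE. Qed.

Lemma tensm_avgK V (y : Sinf_ob V \ox V) :
  tensm (euler1 V) idfun (tensm (@avg V) idfun y) = y.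
Proof.
elim/(@tens_ind R): y => [|x y IHx IHy|b v]; first by rewrite !linear0.
  by rewrite !linearD IHx IHy.
by rewrite !tensmE [X in tens X]avgK.
Qed.

Lemma tensm_euler1K V (y : Sinf_ob V \ox V) :
  tensm (@avg V) idfun (tensm (euler1 V) idfun y) = y.
Proof.
elim/(@tens_ind R): y => [|x y IHx IHy|b v]; first by rewrite !linear0.
  by rewrite !linearD IHx IHy.
by rewrite !tensmE [X in tens X]euler1K.
Qed.

Lemma integ_map V W (f : {linear V -> W}) y :
  integ W (tensm (Sinf_map f) f y) = Sinf_map f (integ V y).
Proof.
elim/(@tens_ind R): y => [|x y IHx IHy|b v]; first by rewrite !linear0.
  by rewrite !linearD IHx IHy.
by rewrite tensmE !integE avg_map (cinf_morphismM (Sinf_map_morphism f)) Sinf_map_eta.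
Qed.

Lemma euler_integ V y : euler V (integ V y) = coderiving M V y.
Proof. by rewrite [LHS]euler_coderiving tensm_avgK. Qed.

Lemma S0_integ V y : S0 V (integ V y) = 0.
Proof. exact: S0_coderiving. Qed.

Lemma integ_der V x : integ V (der x) + S0 V x = x.
Proof.
apply: euler_S0_inj; rewrite linearD.
  by rewrite euler_integ euler_S0 addr0.
by rewrite S0_integ S0_S0 add0r.
Qed.

(** The Rota-Baxter rule [s.2]: by Leibniz and [euler_integ] both sides have the same [L], and S(0)
    kills every integral. *)
Lemma integM V (p q : Sinf_ob V \ox V) :
  (integ V p : Sinf V) * integ V q =
  integ V (tensm (Sinf_mul V) idfun
    (tassocV (Sinf_ob V) (Sinf_ob V) V (tens (integ V p) q))) +
  integ V (tensm (Sinf_mul V) idfun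
    (tswap23 (Sinf_ob V) V (Sinf_ob V) (tens p (integ V q)))).
Proof.
rewrite mul_actl mul_actr; apply: euler_S0_inj.
  by rewrite eulerM linearD !euler_integ !coderiving_act.
rewrite linearD !S0_integ addr0 (cinf_morphismM (Sinf_map_morphism _)).
by rewrite !S0_integ mul0r.
Qed.

(** Applying [L] removes the outer average and leaves [avg x] times two generators, whose order is
    immaterial. *)
Lemma integ_integ V (x : Sinf_ob V) v w :
  integ V (tens (integ V (tens x v)) w) = integ V (tens (integ V (tens x w)) v).
Proof.
apply: euler_S0_inj; last by rewrite !S0_integ.
by rewrite !euler_integ !coderivingE !integE -!mulrA [Sinf_eta v * _]mulrC.
Qed.

(** Leibniz on [x * Sinf_eta v]: differentiating the generator returns [y], differentiating the
    coefficient gives the swapped term. *)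
Lemma der_coderiving V (y : Sinf_ob V \ox V) :
  der (coderiving M V y) =
  y + tensm (coderiving M V) idfun (tswap23 (Sinf_ob V) V V (tensm (Sinf_d V) idfun y)).
Proof.
elim/(@tens_ind R): y => [|x y IHx IHy|x v]; first by rewrite !linear0 addr0.
  rewrite (linearD (coderiving M V)) [der _](linearD (@Sinf_d R V)).
  by rewrite [X in X + _]IHx [X in _ + X]IHy !linearD addrACA.
rewrite coderivingE derM der_eta actE mulr1 tensmE; congr (_ + _).
rewrite -[tens (Sinf_d V x) _]/(tens (der x) v).
elim/(@tens_ind R): (der x) => [|y z IHy IHz|b u].
- by rewrite linear0 linear0l !linear0.
- by rewrite linearD linearDl !linearD IHy IHz.
- by rewrite actE tswap23E tensmE coderivingE mulrC.
Qed.

Lemma der_coderiving_closed V (y : Sinf_ob V \ox V) :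
  tswap23 (Sinf_ob V) V V (tensm (Sinf_d V) idfun y) = tensm (Sinf_d V) idfun y ->
  der (coderiving M V y) = tensm (euler1 V) idfun y.
Proof.
rewrite der_coderiving => ->; elim/(@tens_ind R): y => [|x y IHx IHy|x v].
- by rewrite !linear0 addr0.
- by rewrite !linearD addrACA IHx IHy.
- by rewrite !tensmE euler1E linearDl.
Qed.

Lemma der_integ_closed V (y : Sinf_ob V \ox V) :
  tswap23 (Sinf_ob V) V V (tensm (Sinf_d V) idfun y) = tensm (Sinf_d V) idfun y ->
  der (integ V y) = y.
Proof.
move=> cy; rewrite -[LHS]tensm_euler1K -[RHS]tensm_euler1K; congr (tensm _ _ _).
(* The form [der (integ V y)] is closed by [d.5], so the formula applies to it as well as to [y];
   both sides become [der (coderiving M V y)]. *)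
rewrite -der_coderiving_closed; last by rewrite -der_der_swap.
by rewrite -eulerE euler_integ der_coderiving_closed.
Qed.

(** * Inverting K and the co-calculus axioms *)

Local Notation K V := (Ktrans M (@Sinf_d R) V).

Lemma KE V x : K V x = euler V x + S0 V x.
Proof. by []. Qed.

(** As S(0) kills the image of [L], applying it to [K x] recovers S(0) x; cancelling that leaves
    [L x]. *)
Lemma K_inj V : injective (K V).
Proof.
move=> x y; rewrite !KE => e; have := congr1 (S0 V) e.
rewrite !linearD !S0_S0 !eulerE !S0_coderiving !add0r => sxy.
apply: euler_S0_inj => //; move: e; rewrite sxy; exact: addIr.
Qed.

(** Two averages occur because [L] undoes only one: [L (Kinv x)] is [integ V (der x)], which
    [integ_der] completes to [x] by adding S(0) x. *)
Definition Kinv V : {linear Sinf_ob V -> Sinf_ob V} :=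
  (integ V \o (tensm (@avg V) idfun \o Sinf_d V)) \+ S0 V.

Lemma KinvE V x : Kinv V x = integ V (tensm (@avg V) idfun (der x)) + S0 V x.
Proof. by []. Qed.

Lemma KinvK V x : K V (Kinv V x) = x.
Proof.
rewrite KE KinvE linearD euler_integ euler_S0 addr0 linearD S0_integ S0_S0 add0r.
exact: integ_der.
Qed.

Lemma Kinv_map V W (f : {linear V -> W}) x : Kinv W (Sinf_map f x) = Sinf_map f (Kinv V x).
Proof.
rewrite !KinvE linearD S0_map der_map; congr (_ + _).
rewrite -integ_map; congr (integ W _).
elim/(@tens_ind R): (der x) => [|y z IHy IHz|b u]; first by rewrite !linear0.
  by rewrite !linearD IHy IHz.
by rewrite !tensmE [X in tens X]avg_map.
Qed.

Lemma Sinf_has_antiderivatives : has_antiderivatives M (@Sinf_d R).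
Proof.
exists Kinv; split=> [V W f x|V x|V x].
- exact: Kinv_map.
- by apply: K_inj; exact: KinvK.
- exact: KinvK.
Qed.

(** Since S(0) kills integrals, [K (integ V y)] is [coderiving M V y]; injectivity of [K] does the
    rest. *)
Lemma inverse_K_coderiving V (K' : {linear Sinf_ob V -> Sinf_ob V}) y :
  (forall x, K V (K' x) = x) -> K' (coderiving M V y) = integ V y.
Proof.
by move=> K'K; apply: K_inj; rewrite K'K KE euler_integ S0_integ addr0.
Qed.

Lemma Sinf_is_cocalculus (K' : forall V, {linear Sinf_ob V -> Sinf_ob V}) :
  is_natural_inverse M (Ktrans M (@Sinf_d R)) K' ->
  is_cocalculus M (@Sinf_d R) (fun V => K' V \o coderiving M V).
Proof.
case=> _ _ K'K.
pose s V : {linear Sinf_ob V \ox V -> Sinf_ob V} := K' V \o coderiving M V.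
have sE V y : s V y = integ V y by exact: (inverse_K_coderiving _ (K'K V)).
have sI : s = integ.
  by apply: functional_extensionality_dep => V; apply: linear_eq; exact: sE.
rewrite -/s sI; split.
- by split; [exact: Sinf_is_algebra_modality|exact: Sinf_d_deriving].
- split; first exact: Sinf_is_algebra_modality.
  split.
  + by move=> V W f x; exact: integ_map.
  + move=> V v; unfold_modality.
    by rewrite tlunitVE tensmE Sinf_oneE integE avg1 mul1r.
  + move=> V x; unfold_modality; rewrite [RHS]/GRing.add_fun; unfold_modality.
    elim/(@tens_ind R): x => [|x y IHx IHy|p q].
    * by rewrite !linear0 addr0.
    * by rewrite !linearD IHx IHy addrACA.
    * by rewrite !tensmE Sinf_mulE; exact: integM.
  + move=> V x; unfold_modality.
    elim/(@tens_ind R): x => [|x y IHx IHy|x w].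
    * by rewrite !linear0.
    * by rewrite !linearD IHx IHy.
    elim/(@tens_ind R): x => [|x y IHx IHy|x v].
    * by rewrite linear0l !linear0.
    * by rewrite linearDl !linearD IHx IHy.
    * by rewrite tswap23E !tensmE integ_integ.
- by move=> V x; exact: integ_der.
- by move=> B C f cf b; apply: der_integ_closed; exact: (cf b).
Qed.

End antiderivatives.

Theorem theorem6p3 (R : realType) :
  (exists! d : forall V : lmodType R, {linear Sinf_ob V -> Sinf_ob V \ox V},
     is_Sinf_deriving d) /\
  (forall d, is_Sinf_deriving d ->
     [/\ is_codifferential (Sinf_modality R) d,
         has_antiderivatives (Sinf_modality R) d
       & forall K' : forall V : lmodType R, {linear Sinf_ob V -> Sinf_ob V},
           is_natural_inverse (Sinf_modality R) (Ktrans (Sinf_modality R) d) K' ->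
           is_cocalculus (Sinf_modality R) d
             (fun V => K' V \o coderiving (Sinf_modality R) V)]).
Proof.
split=> [|d /Sinf_deriving_uniq ->].
  exists (@Sinf_d R); split; first exact: Sinf_d_is_deriving.
  by move=> d /Sinf_deriving_uniq.
split; last exact: Sinf_is_cocalculus.
- by split; [exact: Sinf_is_algebra_modality|exact: Sinf_d_deriving].
- exact: Sinf_has_antiderivatives.
Qed.
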